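(* Let $p\in\mathcal P$ with $d_Qp=0$. Then $p$ is cohomologous (i.e. differs by an element $d_Q b$, $b\in\mathcal P$) to a polynomial in the variables $u_\mu$, $u_{\mu\nu}$ and $R^{(0)}_{\mu\nu;\rho\sigma;\lambda_1\dots\lambda_n}$ ($n\ge0$).
   Context: Minkowski metric $\eta=\mathrm{diag}(1,-1,-1,-1)$. $\mathcal P$ is the graded-commutative algebra of polynomials in the jet variables $y^\alpha_{\nu_1\dots\nu_n}$ ($n\ge0$) of the classical massless fields $y^\alpha\in\{h_{\mu\nu}$ (symmetric, even), $u_\rho$ (odd), $\tilde u_\sigma$ (odd)$\}$, the jet variables being taken modulo the wave equation (so traces in derivative indices vanish). Formal derivatives: $d_\mu y^\alpha_{\nu_1\dots\nu_n}=y^\alpha_{\mu\nu_1\dots\nu_n}$. Ghost number $gh(h)=0$, $gh(u)=1$, $gh(\tilde u)=-1$; canonical dimension $1$ for each field plus $1$ per derivative. $d_Q$ is the graded derivation of $\mathcal P$ with $d_Qh_{\mu\nu}=-\frac i2(d_\mu u_\nu+d_\nu u_\mu-\eta_{\mu\nu}d_\rho u^\rho)$, $d_Qu_\mu=0$, $d_Q\tilde u_\mu=i\,d^\nu h_{\mu\nu}$, $[d_Q,d_\mu]=0$ (so $d_Q^2=0$). Notation: $h=\eta^{\mu\nu}h_{\mu\nu}$, $\hat h_{\mu\nu}=h_{\mu\nu}-\frac12\eta_{\mu\nu}h$, $\Gamma_{\mu;\nu\rho}=d_\rho\hat h_{\mu\nu}+d_\nu\hat h_{\mu\rho}-d_\mu\hat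 h_{\nu\rho}$, $R_{\mu\nu;\rho\sigma}=d_\rho\Gamma_{\mu;\nu\sigma}-d_\sigma\Gamma_{\mu;\nu\rho}$, $u_{\mu\nu}=\frac12(d_\mu u_\nu-d_\nu u_\mu)$, and $R^{(0)}_{\mu\nu;\rho\sigma;\lambda_1\dots\lambda_n}$ is the traceless part (in all indices) of $d_{\lambda_1}\cdots d_{\lambda_n}R_{\mu\nu;\rho\sigma}$. *)

(* Defs.v *)
(* Formalization of the BRST complex of linearized gravity
   (Scharf-style free graviton with ghosts u, anti-ghosts ut). *)
From HB Require Import structures.
From mathcomp Require Import all_boot all_order all_algebra.
From Stdlib Require Import ClassicalEpsilon.
Set Implicit Arguments. Unset Strict Implicit. Unset Printing Implicit Defensive.
Import Order.TTheory GRing.Theory Num.Theory.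
Local Open Scope ring_scope.

Inductive fld : Type := fH (m n : 'I_4) | fU (m : 'I_4) | fUt (m : 'I_4).

(* A jet variable y^alpha_{nu_1 ... nu_n}: a field label and the list of
   derivative indices [nu_1; ...; nu_n]. *)
Definition gen : Type := (fld * seq 'I_4)%type.

Definition odd_fld (f : fld) : bool :=
  match f with fH _ _ => false | _ => true end.

(* Syntactic expressions of the free (noncommutative) F-algebra on the jet
   variables; the algebra P is obtained as the quotient by [peq] below. *)
Inductive expr (F : Type) : Type :=
| Var (g : gen)
| Const (c : F)
| Add (a b : expr F)
| Mul (a b : expr F).
Arguments Var {F} g.

Section Defs.
Variable F : numClosedFieldType.

Definition eta (m n : 'I_4) : F :=
  if m == n then (if val m == 0%N then 1 else -1) else 0.

Definition scal (c : F) (e : expr F) : expr F := Mul (Const c) e.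
Definition sub (a b : expr F) : expr F := Add a (scal (-1) b).
Definition esum (l : seq (expr F)) : expr F := foldr (@Add F) (Const 0) l.
Definition esum4 (f : 'I_4 -> expr F) : expr F := esum [seq f k | k <- enum 'I_4].

Definition gsign (g g' : gen) : F :=
  if odd_fld g.1 && odd_fld g'.1 then -1 else 1.

(* The algebra P: free F-algebra on the jet variables modulo
   graded commutativity, symmetry of derivative indices, symmetry of h,
   and the wave equation (vanishing of traces in derivative indices). *)
Inductive peq : expr F -> expr F -> Prop :=
| peq_refl a : peq a a
| peq_sym a b : peq a b -> peq b a
| peq_trans a b c : peq a b -> peq b c -> peq a c
| peq_add a a' b b' : peq a a' -> peq b b' -> peq (Add a b) (Add a' b')
| peq_mul a a' b b' : peq a a' -> peq b b' -> peq (Mul a b) (Mul a' b')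
| peq_addA a b c : peq (Add a (Add b c)) (Add (Add a b) c)
| peq_addC a b : peq (Add a b) (Add b a)
| peq_add0 a : peq (Add (Const 0) a) a
| peq_addN a : peq (Add a (Mul (Const (-1)) a)) (Const 0)
| peq_mulA a b c : peq (Mul a (Mul b c)) (Mul (Mul a b) c)
| peq_mul1l a : peq (Mul (Const 1) a) a
| peq_mul1r a : peq (Mul a (Const 1)) a
| peq_mulDl a b c : peq (Mul (Add a b) c) (Add (Mul a c) (Mul b c))
| peq_mulDr a b c : peq (Mul a (Add b c)) (Add (Mul a b) (Mul a c))
| peq_constD (x y : F) : peq (Add (Const x) (Const y)) (Const (x + y))
| peq_constM (x y : F) : peq (Mul (Const x) (Const y)) (Const (x * y))
| peq_constC (x : F) a : peq (Mul (Const x) a) (Mul a (Const x))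
| peq_gcomm (g g' : gen) :
    peq (Mul (Var g) (Var g')) (Mul (Const (gsign g g')) (Mul (Var g') (Var g)))
| peq_jet_perm (y : fld) (s s' : seq 'I_4) :
    perm_eq s s' -> peq (Var (y, s)) (Var (y, s'))
| peq_hsym (m n : 'I_4) (s : seq 'I_4) : peq (Var (fH m n, s)) (Var (fH n m, s))
| peq_wave (y : fld) (s : seq 'I_4) :
    peq (esum4 (fun k => scal (eta k k) (Var (y, k :: k :: s)))) (Const 0).

Fixpoint dd (m : 'I_4) (e : expr F) : expr F :=
  match e with
  | Var g => Var (g.1, m :: g.2)
  | Const _ => Const 0
  | Add a b => Add (dd m a) (dd m b)
  | Mul a b => Add (Mul (dd m a) b) (Mul a (dd m b))
  end.

Definition dds (s : seq 'I_4) (e : expr F) : expr F := foldr dd e s.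

Fixpoint par (e : expr F) : expr F :=
  match e with
  | Var g => if odd_fld g.1 then Mul (Const (-1)) (Var g) else Var g
  | Const c => Const c
  | Add a b => Add (par a) (par b)
  | Mul a b => Mul (par a) (par b)
  end.

(* d_Q on generators (using [d_Q, d_mu] = 0) *)
Definition dQgen (g : gen) : expr F :=
  let s := g.2 in
  match g.1 with
  | fH m n =>
      scal (- 'i / 2%:R)
        (Add (Add (Var (fU n, m :: s)) (Var (fU m, n :: s)))
             (scal (- eta m n) (esum4 (fun r => scal (eta r r) (Var (fU r, r :: s))))))
  | fU _ => Const 0
  | fUt m => scal 'i (esum4 (fun n => scal (eta n n) (Var (fH m n, n :: s))))
  end.

Fixpoint dQ (e : expr F) : expr F :=
  match e with
  | Var g => dQgen g
  | Const _ => Const 0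
  | Add a b => Add (dQ a) (dQ b)
  | Mul a b => Add (Mul (dQ a) b) (Mul (par a) (dQ b))
  end.

Definition htr : expr F := esum4 (fun k => scal (eta k k) (Var (fH k k, [::]))).
Definition hhat (m n : 'I_4) : expr F := sub (Var (fH m n, [::])) (scal (eta m n / 2%:R) htr).
Definition Gam (m n r : 'I_4) : expr F :=
  sub (Add (dd r (hhat m n)) (dd n (hhat m r))) (dd m (hhat n r)).
Definition Riem (m n r sg : 'I_4) : expr F := sub (dd r (Gam m n sg)) (dd sg (Gam m n r)).
Definition uu (m n : 'I_4) : expr F :=
  scal (1 / 2%:R) (sub (dd m (Var (fU n, [::]))) (dd n (Var (fU m, [::])))).

(* Tensors of rank k: functions on index lists (of length k), all indices down. *)
Definition tensor := seq 'I_4 -> expr F.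

Definition dRtens : tensor := fun s =>
  dds (drop 4 s) (Riem (nth ord0 s 0) (nth ord0 s 1) (nth ord0 s 2) (nth ord0 s 3)).

Definition trace_at (T : tensor) (i j : nat) (s : seq 'I_4) : expr F :=
  esum4 (fun k => scal (eta k k) (T (set_nth ord0 (set_nth ord0 s i k) j k))).

Definition is_traceless (k : nat) (T : tensor) : Prop :=
  forall s, size s = k -> forall i j, (i < j)%N -> (j < k)%N ->
    peq (trace_at T i j s) (Const 0).

Definition pairs (k : nat) : seq (nat * nat) :=
  [seq ij <- [seq (i, j) | i <- iota 0 k, j <- iota 0 k] | (ij.1 < ij.2)%N].

Definition rem2 (s : seq 'I_4) (i j : nat) : seq 'I_4 :=
  [seq x.2 | x <- zip (iota 0 (size s)) s & (x.1 != i) && (x.1 != j)].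

Definition in_eta_ideal (k : nat) (W : tensor) : Prop :=
  exists Y : nat -> nat -> tensor, forall s, size s = k ->
    peq (W s) (esum [seq scal (eta (nth ord0 s ij.1) (nth ord0 s ij.2))
                             (Y ij.1 ij.2 (rem2 s ij.1 ij.2)) | ij <- pairs k]).

(* traceless part of a rank-k tensor: the Z traceless in all index pairs
   with T - Z in the eta-ideal (unique up to peq). *)
Definition traceless_part (k : nat) (T : tensor) : tensor :=
  epsilon (inhabits (fun _ => Const 0))
    (fun Z => is_traceless k Z /\ in_eta_ideal k (fun s => sub (T s) (Z s))).

Definition R0 (n : nat) : tensor := traceless_part (4 + n) dRtens.

Definition target_gen (e : expr F) : Prop :=
  (exists m, e = Var (fU m, [::])) \/
  (exists m n, e = uu m n) \/
  (exists n s, size s = (4 + n)%N /\ e = R0 n s).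

Inductive poly_in (S : expr F -> Prop) : expr F -> Prop :=
| pi_gen e : S e -> poly_in S e
| pi_const c : poly_in S (Const c)
| pi_add a b : poly_in S a -> poly_in S b -> poly_in S (Add a b)
| pi_mul a b : poly_in S a -> poly_in S b -> poly_in S (Mul a b).

End Defs.

(* Main.v *)
(** The jet algebra is the symmetric algebra, in the graded sense, of the complex
    ut -> h -> u of linear jets.  In characteristic zero its cohomology is therefore
    governed by the linear one: a contraction K of the linear complex onto a
    complement of the exact jets extends to an odd derivation, N = dQ K + K dQ is a
    derivation which counts the non-target factors of a monomial, and a closed
    eigenvector of N with nonzero eigenvalue is exact.

    Linear jets of one field form F[x0,..,x3] modulo the quadric x^2.  A closed
    combination K^{mn}(d) of metric perturbations satisfies x_m K^{mn} = x^2 D^n;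
    subtracting dQ of a combination of anti-ghosts with coefficients 2D^n makes K
    divergence free as a polynomial, hence, by Euler's identity, a double divergence,
    so that it pairs with the linearized curvature.  Closed anti-ghost jets vanish
    because x_0 is not a zero divisor modulo x^2.  Finally all traces of derivatives
    of the curvature are exact, and the traceless projection changes a tensor by
    combinations of its traces. *)

Require Import Defs.
From HB Require Import structures.
From mathcomp Require Import all_boot all_order all_algebra.
From mathcomp Require Import ring.
From mathcomp.multinomials Require Import ssrcomplements mpoly.
From Stdlib Require Import ClassicalEpsilon.
Import Defs.
Set Implicit Arguments. Unset Strict Implicit. Unset Printing Implicit Defensive.
Import Order.TTheory GRing.Theory Num.Theory.
Local Open Scope ring_scope.

(** * The quotient algebra *)

(** [P] is given by generators and relations, and no normal form of monomials is ever computed.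
    Whatever is needed about [P] comes from maps defined on syntax and checked against each
    relation: the parity, the derivations, the augmentation, and [lin], which reads off linear
    coefficients modulo the quadric. For the same reason [K] is not written down jet by jet:
    symmetry and the wave equation make jets linearly dependent, so [K] is given through coordinates
    in a basis extracted from them. Matrix algebra needs finite dimension, hence the truncation by
    [wt], the number of derivatives shifted per field so that [dQ] preserves it; the contraction
    then depends on the polynomial at hand through a bound on its weights. To extend to an odd
    derivation a contraction must reverse parity, which an arbitrary pseudo-inverse does not;
    averaging over the parity involution repairs this. Since the metric is indefinite, traces are
    split off by a positive semidefinite operator for the auxiliary Euclidean product on
    components. *)

Definition fld_code (f : fld) : ('I_4 * 'I_4) + ('I_4 + 'I_4) :=
  match f with fH m n => inl (m, n) | fU m => inr (inl m) | fUt m => inr (inr m) end.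
Definition fld_decode (c : ('I_4 * 'I_4) + ('I_4 + 'I_4)) : fld :=
  match c with inl mn => fH mn.1 mn.2 | inr (inl m) => fU m | inr (inr m) => fUt m end.
Lemma fld_codeK : cancel fld_code fld_decode. Proof. by case. Qed.
HB.instance Definition _ := Countable.copy fld (can_type fld_codeK).
HB.instance Definition _ := Choice.on gen.

Section ExprChoice.
Variable F : choiceType.

(** The quotient construction requires a choice structure on expressions; it is transported from
    generic trees. *)
Fixpoint expr_code (e : expr F) : GenTree.tree (gen + F) :=
  match e with
  | Var g => GenTree.Leaf (inl g)
  | Const c => GenTree.Leaf (inr c)
  | Add a b => GenTree.Node 0 [:: expr_code a; expr_code b]
  | Mul a b => GenTree.Node 1 [:: expr_code a; expr_code b]
  end.
Fixpoint expr_decode (t : GenTree.tree (gen + F)) : option (expr F) :=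
  match t with
  | GenTree.Leaf (inl g) => Some (Var g)
  | GenTree.Leaf (inr c) => Some (Const c)
  | GenTree.Node n [:: t1; t2] =>
      match expr_decode t1, expr_decode t2 with
      | Some a, Some b => Some (if n is 0 then Add a b else Mul a b)
      | _, _ => None
      end
  | _ => None
  end.
Lemma expr_codeK : pcancel expr_code expr_decode.
Proof. by elim=> //= a -> b ->. Qed.
HB.instance Definition _ := Choice.copy (expr F) (pcan_type expr_codeK).
End ExprChoice.

Section JetAlgebra.
Variable F : numClosedFieldType.
Implicit Types (a b e : expr F) (g : gen).

Definition peqb a b : bool :=
  if excluded_middle_informative (peq a b) then true else false.
Lemma peqbP a b : reflect (peq a b) (peqb a b).
Proof. by rewrite /peqb; case: excluded_middle_informative => h; constructor. Qed.
Lemma peqb_refl : reflexive peqb.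
Proof. by move=> a; apply/peqbP; apply: peq_refl. Qed.
Lemma peqb_sym a b : peqb a b = peqb b a.
Proof. by apply/peqbP/peqbP; apply: peq_sym. Qed.
Lemma peqb_trans : transitive peqb.
Proof. by move=> b a c /peqbP ab /peqbP bc; apply/peqbP; apply: peq_trans ab bc. Qed.
Canonical peq_equiv := EquivRel peqb peqb_refl peqb_sym peqb_trans.

Definition jetalg : Type := {eq_quot peq_equiv}%qT.
HB.instance Definition _ := Choice.on jetalg.

Definition cls e : jetalg := (\pi_({eq_quot peq_equiv}) e)%qT.
Definition rep (x : jetalg) : expr F := repr (x : {eq_quot peq_equiv}%qT).

Lemma repK : cancel rep cls. Proof. exact: reprK. Qed.
Lemma clsP a b : cls a = cls b <-> peq a b.
Proof.
by split=> [/eqP|] h; [apply/peqbP; rewrite eqmodE in h | apply/eqP; rewrite eqmodE; apply/peqbP].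
Qed.
Lemma rep_cls e : peq (rep (cls e)) e. Proof. by apply/clsP; rewrite repK. Qed.
Lemma cls_ind (Q : jetalg -> Prop) : (forall e, Q (cls e)) -> forall x, Q x.
Proof. by move=> h x; rewrite -(repK x). Qed.

Definition jadd (x y : jetalg) := cls (Add (rep x) (rep y)).
Definition jmul (x y : jetalg) := cls (Mul (rep x) (rep y)).
Definition jscale (c : F) (x : jetalg) := cls (Mul (Const c) (rep x)).
Definition jopp := jscale (-1).

Lemma jaddE a b : jadd (cls a) (cls b) = cls (Add a b).
Proof. by apply/clsP/peq_add; apply: rep_cls. Qed.
Lemma jmulE a b : jmul (cls a) (cls b) = cls (Mul a b).
Proof. by apply/clsP/peq_mul; apply: rep_cls. Qed.
Lemma jscaleE c a : jscale c (cls a) = cls (Mul (Const c) a).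
Proof. by apply/clsP/peq_mul; [apply: peq_refl | apply: rep_cls]. Qed.

Fact jaddA : associative jadd.
Proof. elim/cls_ind=> a; elim/cls_ind=> b; elim/cls_ind=> c.
by rewrite !jaddE; apply/clsP/peq_addA. Qed.
Fact jaddC : commutative jadd.
Proof. by elim/cls_ind=> a; elim/cls_ind=> b; rewrite !jaddE; apply/clsP/peq_addC. Qed.
Fact jadd0 : left_id (cls (Const 0)) jadd.
Proof. by elim/cls_ind=> a; rewrite jaddE; apply/clsP/peq_add0. Qed.
Fact jaddN : left_inverse (cls (Const 0)) jopp jadd.
Proof. elim/cls_ind=> a; rewrite jaddC [jopp _]jscaleE jaddE; apply/clsP/peq_addN. Qed.
Fact jmulA : associative jmul.
Proof. elim/cls_ind=> a; elim/cls_ind=> b; elim/cls_ind=> c.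
by rewrite !jmulE; apply/clsP/peq_mulA. Qed.
Fact jmul1l : left_id (cls (Const 1)) jmul.
Proof. by elim/cls_ind=> a; rewrite jmulE; apply/clsP/peq_mul1l. Qed.
Fact jmul1r : right_id (cls (Const 1)) jmul.
Proof. by elim/cls_ind=> a; rewrite jmulE; apply/clsP/peq_mul1r. Qed.
Fact jmulDl : left_distributive jmul jadd.
Proof. elim/cls_ind=> a; elim/cls_ind=> b; elim/cls_ind=> c.
by rewrite !(jmulE, jaddE); apply/clsP/peq_mulDl. Qed.
Fact jmulDr : right_distributive jmul jadd.
Proof. elim/cls_ind=> a; elim/cls_ind=> b; elim/cls_ind=> c.
by rewrite !(jmulE, jaddE); apply/clsP/peq_mulDr. Qed.

(* The augmentation, which shows that the quotient is not the zero ring. *)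
Fixpoint aug e : F :=
  match e with
  | Var _ => 0
  | Const c => c
  | Add a b => aug a + aug b
  | Mul a b => aug a * aug b
  end.

Lemma aug_esum (l : seq (expr F)) : aug (esum l) = \sum_(x <- l) aug x.
Proof. by elim: l => [|x l IH]; rewrite /= ?big_nil // big_cons -IH. Qed.

Lemma aug_peq a b : peq a b -> aug a = aug b.
Proof.
elim=> //=.
- by move=> {}a {}b c _ -> _ ->.
- by move=> {}a a' {}b b' _ -> _ ->.
- by move=> {}a a' {}b b' _ -> _ ->.
- by move=> *; rewrite addrA.
- by move=> *; rewrite addrC.
- by move=> *; rewrite add0r.
- by move=> *; rewrite mulN1r subrr.
- by move=> *; rewrite mulrA.
- by move=> *; rewrite mul1r.
- by move=> *; rewrite mulr1.
- by move=> *; rewrite mulrDl.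
- by move=> *; rewrite mulrDr.
- by move=> *; rewrite mulrC.
- by move=> *; rewrite !(mulr0, mul0r).
- move=> y s; rewrite aug_esum big_map big1 // => i _ /=; exact: mulr0.
Qed.

Fact jone_neq0 : cls (Const 1) != cls (Const 0).
Proof. by apply/eqP => /clsP/aug_peq /= /eqP; rewrite oner_eq0. Qed.

HB.instance Definition _ := GRing.isNmodule.Build jetalg jaddA jaddC jadd0.
HB.instance Definition _ := GRing.Nmodule_isZmodule.Build jetalg jaddN.
HB.instance Definition _ := GRing.Zmodule_isNzRing.Build jetalg
  jmulA jmul1l jmul1r jmulDl jmulDr jone_neq0.

Lemma clsD a b : cls (Add a b) = cls a + cls b. Proof. by rewrite -jaddE. Qed.
Lemma clsM a b : cls (Mul a b) = cls a * cls b. Proof. by rewrite -jmulE. Qed.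

Fact jscaleA c d x : jscale c (jscale d x) = jscale (c * d) x.
Proof. elim/cls_ind: x => a; rewrite !jscaleE; apply/clsP.
apply: peq_trans (peq_mulA _ _ _) _; apply: peq_mul (peq_constM _ _) (peq_refl _). Qed.
Fact jscale1 : left_id 1 jscale. 
Proof. by elim/cls_ind=> a; rewrite jscaleE; apply/clsP/peq_mul1l. Qed.
Fact jscaleDr : right_distributive jscale +%R.
Proof. by move=> c; elim/cls_ind=> a; elim/cls_ind=> b; rewrite -clsD !jscaleE -clsD; apply/clsP/peq_mulDr. Qed.
Fact jscaleDl x : {morph jscale^~ x : c d / c + d}.
Proof. elim/cls_ind: x => a c d; rewrite !jscaleE -clsD; apply/clsP.
apply: peq_trans (peq_mulDl _ _ _); apply: peq_mul (peq_refl _).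
exact: peq_sym (peq_constD _ _). Qed.
HB.instance Definition _ := GRing.Zmodule_isLmodule.Build F jetalg
  jscaleA jscale1 jscaleDr jscaleDl.

Lemma clsZ c a : cls (Mul (Const c) a) = c *: cls a. Proof. by rewrite -jscaleE. Qed.
Lemma cls1 : cls (Const 1) = 1. Proof. by []. Qed.
Lemma cls0 : cls (Const 0) = 0. Proof. by []. Qed.
Lemma clsC c : cls (Const c) = c *: (1 : jetalg).
Proof. by rewrite -cls1 -clsZ; apply/esym/clsP/peq_mul1r. Qed.

Fact jscaleAl (c : F) (x y : jetalg) : c *: (x * y) = (c *: x) * y.
Proof. elim/cls_ind: x => a; elim/cls_ind: y => b.
by rewrite -clsM -!clsZ -clsM; apply/clsP/peq_mulA. Qed.
HB.instance Definition _ := GRing.Lmodule_isLalgebra.Build F jetalg jscaleAl.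
Fact jscaleAr (c : F) (x y : jetalg) : c *: (x * y) = x * (c *: y).
Proof. elim/cls_ind: x => a; elim/cls_ind: y => b.
rewrite jscaleAl -!clsZ -!clsM; apply/clsP.
apply: peq_trans (peq_sym (peq_mulA _ _ _)).
exact: peq_mul (peq_constC _ _) (peq_refl _). Qed.
HB.instance Definition _ := GRing.Lalgebra_isAlgebra.Build F jetalg jscaleAr.

Definition jet g : jetalg := cls (Var g).

Lemma cls_sub a b : cls (sub a b) = cls a - cls b.
Proof. by rewrite clsD clsZ scaleN1r. Qed.
Lemma cls_esum (l : seq (expr F)) : cls (esum l) = \sum_(x <- l) cls x.
Proof. by elim: l => [|x l IH]; rewrite /= ?big_nil // big_cons clsD IH. Qed.
Lemma cls_esum4 (f : 'I_4 -> expr F) : cls (esum4 f) = \sum_k cls (f k).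
Proof. by rewrite cls_esum big_map big_enum. Qed.

Lemma jet_gcomm g g' : jet g * jet g' = gsign F g g' *: (jet g' * jet g).
Proof. by rewrite -!clsM -clsZ; apply/clsP/peq_gcomm. Qed.
Lemma jet_perm y s s' : perm_eq s s' -> jet (y, s) = jet (y, s').
Proof. by move=> h; apply/clsP/peq_jet_perm. Qed.
Lemma jet_hsym m n s : jet (fH m n, s) = jet (fH n m, s).
Proof. exact/clsP/peq_hsym. Qed.
Lemma jet_wave y s : \sum_k eta F k k *: jet (y, k :: k :: s) = 0.
Proof.
under eq_bigr do rewrite -clsZ; rewrite -cls_esum4 -cls0; exact/clsP/peq_wave.
Qed.

End JetAlgebra.

(** * Derivations *)

Section Derivations.
Variable F : numClosedFieldType.
Implicit Types (a b e : expr F) (g : gen) (x y : jetalg F).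

Lemma jetalg_ind (Q : jetalg F -> Prop) :
  (forall g, Q (jet F g)) -> (forall c, Q (c *: 1)) ->
  (forall x y, Q x -> Q y -> Q (x + y)) -> (forall x y, Q x -> Q y -> Q (x * y)) ->
  forall x, Q x.
Proof.
move=> Qj Qc QD QM; elim/cls_ind; elim=> [g|c|a ha b hb|a ha b hb].
- exact: Qj.
- by rewrite clsC.
- by rewrite clsD; apply: QD.
- by rewrite clsM; apply: QM.
Qed.

Definition psign g : F := if odd_fld g.1 then -1 else 1.

Lemma psign_sq g : psign g * psign g = 1.
Proof. by rewrite /psign; case: ifP; rewrite ?mulrNN mulr1. Qed.

Lemma cls_par_var g : cls (par (Var g)) = psign g *: jet F g.
Proof. by rewrite /= /psign; case: ifP; rewrite ?clsZ ?scale1r. Qed.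

Lemma par_peq a b : peq a b -> cls (par a) = cls (par b).
Proof.
elim => //.
- by move=> {}a {}b c _ -> _ ->.
- by move=> {}a a' {}b b' _ ha _ hb; rewrite /= !clsD ha hb.
- by move=> {}a a' {}b b' _ ha _ hb; rewrite /= !clsM ha hb.
- by move=> *; rewrite /= !clsD addrA.
- by move=> *; rewrite /= !clsD addrC.
- by move=> *; rewrite /= !clsD cls0 add0r.
- by move=> *; rewrite /= !clsD clsZ scaleN1r subrr.
- by move=> *; rewrite /= !clsM mulrA.
- by move=> *; rewrite /= !clsM cls1 mul1r.
- by move=> *; rewrite /= !clsM cls1 mulr1.
- by move=> *; rewrite /= !(clsM, clsD) mulrDl.
- by move=> *; rewrite /= !(clsM, clsD) mulrDr.
- by move=> *; apply/clsP/peq_constD.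
- by move=> *; apply/clsP/peq_constM.
- by move=> *; apply/clsP/peq_constC.
- move=> g g'; rewrite ![par (Mul _ _)]/= !clsM !cls_par_var clsC -!(scalerAl, scalerAr) mul1r.
  by rewrite jet_gcomm !scalerA; congr (_ *: _); ring.
- by move=> y s s' h; rewrite !cls_par_var; congr (_ *: _); apply: jet_perm.
- by move=> m n s; apply/clsP/peq_hsym.
- move=> y s; rewrite /esum4; set l := enum _.
  have -> : cls (par (esum [seq scal (eta F k k) (Var (y, k :: k :: s)) | k <- l])) =
      psign (y, s) *: \sum_(k <- l) eta F k k *: jet F (y, k :: k :: s).
    elim: l => [|k l IH]; first by rewrite big_nil scaler0.
    rewrite big_cons [par _]/= clsD IH scalerDr clsZ; congr (_ + _).
    by rewrite cls_par_var !scalerA mulrC.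
  by rewrite big_enum /= jet_wave scaler0.
Qed.

Definition parP x : jetalg F := cls (par (rep x)).
Lemma parP_cls e : parP (cls e) = cls (par e).
Proof. exact/par_peq/rep_cls. Qed.
Fact parP_linear : linear parP.
Proof.
move=> c; elim/cls_ind=> a; elim/cls_ind=> b.
by rewrite -clsZ -clsD !parP_cls /= clsD clsZ.
Qed.
HB.instance Definition _ := GRing.isLinear.Build F _ _ _ parP parP_linear.
Fact parP_monoid : monoid_morphism parP.
Proof.
split=> [|]; first by rewrite -cls1 parP_cls.
by elim/cls_ind=> a; elim/cls_ind=> b; rewrite -clsM !parP_cls /= clsM.
Qed.
HB.instance Definition _ := GRing.isMonoidMorphism.Build _ _ parP parP_monoid.

Lemma parP_jet g : parP (jet F g) = psign g *: jet F g.
Proof. by rewrite parP_cls cls_par_var. Qed.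

Lemma parPK x : parP (parP x) = x.
Proof.
elim/jetalg_ind: x => [g|c|x y hx hy|x y hx hy].
- by rewrite parP_jet linearZ /= parP_jet scalerA psign_sq scale1r.
- by rewrite !linearZ /= !rmorph1.
- by rewrite !linearD /= hx hy.
- by rewrite !rmorphM /= hx hy.
Qed.

Definition augP x : F^o := aug (rep x).
Lemma augP_cls e : augP (cls e) = aug e.
Proof. exact/aug_peq/rep_cls. Qed.
Fact augP_linear : linear augP.
Proof.
move=> c; elim/cls_ind=> a; elim/cls_ind=> b.
by rewrite -clsZ -clsD !augP_cls.
Qed.
HB.instance Definition _ := GRing.isLinear.Build F _ _ _ augP augP_linear.
Fact augP_monoid : monoid_morphism augP.
Proof.
split=> [|]; first by rewrite -cls1 augP_cls.
by elim/cls_ind=> a; elim/cls_ind=> b; rewrite -clsM !augP_cls.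
Qed.
HB.instance Definition _ := GRing.isMonoidMorphism.Build _ _ augP augP_monoid.
Lemma augP_jet g : augP (jet F g) = 0. Proof. by rewrite augP_cls. Qed.

Section Extension.
Variables (B : algType F) (alpha beta : {lrmorphism jetalg F -> B}) (k : gen -> B).
Hypothesis k_gcomm : forall g g',
  k g * beta (jet F g') + alpha (jet F g) * k g' =
  gsign F g g' *: (k g' * beta (jet F g) + alpha (jet F g') * k g).
Hypothesis k_perm : forall f s s', perm_eq s s' -> k (f, s) = k (f, s').
Hypothesis k_hsym : forall m n s, k (fH m n, s) = k (fH n m, s).
Hypothesis k_wave : forall f s, \sum_i eta F i i *: k (f, i :: i :: s) = 0.

Fixpoint der e : B :=
  match e with
  | Var g => k g
  | Const _ => 0
  | Add a b => der a + der b
  | Mul a b => der a * beta (cls b) + alpha (cls a) * der b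
  end.

Lemma der_scal c a : der (Mul (Const c) a) = c *: der a.
Proof. by rewrite /= mul0r add0r clsC linearZ /= rmorph1 -scalerAl mul1r. Qed.

Lemma der_peq a b : peq a b -> der a = der b.
Proof.
elim => //.
- by move=> {}a {}b c _ -> _ ->.
- by move=> {}a a' {}b b' _ ha _ hb; rewrite /= ha hb.
- move=> {}a a' {}b b' /clsP ab ha /clsP ab' hb.
  by rewrite /= ha hb ab ab'.
- by move=> *; rewrite /= addrA.
- by move=> *; rewrite /= addrC.
- by move=> *; rewrite /= add0r.
- move=> {}a; rewrite -[LHS]/(der a + der (Mul (Const (-1)) a)).
  by rewrite der_scal scaleN1r subrr.
- by move=> {}a {}b c; rewrite /= !clsM !rmorphM !mulrDl !mulrDr !mulrA addrA.
- by move=> {}a; rewrite der_scal scale1r.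
- by move=> {}a; rewrite /= cls1 rmorph1 mulr1 mulr0 addr0.
- move=> {}a {}b c; rewrite /= !clsD !linearD /= !mulrDl -!addrA; congr (_ + _).
  by rewrite addrCA.
- move=> {}a {}b c; rewrite /= !clsD !linearD /= !mulrDr -!addrA; congr (_ + _).
  by rewrite addrCA.
- by move=> *; rewrite /= addr0.
- by move=> *; rewrite /= mul0r mulr0 addr0.
- move=> c {}a; rewrite der_scal /= mulr0 addr0 clsC linearZ /= rmorph1.
  by rewrite -scalerAr mulr1.
- by move=> g g'; rewrite der_scal; apply: k_gcomm.
- move=> y s; rewrite /esum4; set l := enum _.
  have -> : der (esum [seq scal (eta F i i) (Var (y, i :: i :: s)) | i <- l]) =
      \sum_(i <- l) eta F i i *: k (y, i :: i :: s).
    elim: l => [|i l IH]; first by rewrite big_nil.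
    by rewrite big_cons -IH -[k _]/(der (Var _)) -der_scal.
  by rewrite big_enum /= k_wave.
Qed.

(** The two twists serve three purposes: [parP] and the identity give odd derivations, two
    identities give the formal derivatives, and two augmentations extract the linear part. The
    hypotheses on [k] are what the relations between jets demand; the algebra axioms are respected
    for any [k]. *)
Lemma derivation_ext : {D : {linear jetalg F -> B} |
  (forall g, D (jet F g) = k g) /\
  (forall x y, D (x * y) = D x * beta y + alpha x * D y)}.
Proof.
pose D x := der (rep x).
have Dcls e : D (cls e) = der e by apply/der_peq/rep_cls.
have Dlin : linear D.
  move=> c; elim/cls_ind=> a; elim/cls_ind=> b.
  by rewrite -clsZ -clsD !Dcls -der_scal.
pose DL := GRing.isLinear.Build F _ _ _ D Dlin.
exists (HB.pack_for {linear jetalg F -> B} D DL); split=> [g|]; first exact: Dcls.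
by elim/cls_ind=> a; elim/cls_ind=> b; rewrite -clsM /= !Dcls.
Qed.

End Extension.
End Derivations.

(** * Linear spans of a predicate *)

Section Span.
Variables (R : pzRingType) (V : lmodType R) (A : V -> Prop).

Inductive lspan : V -> Prop :=
| lspan0 : lspan 0
| lspan_cons c x y : A x -> lspan y -> lspan (c *: x + y).

Lemma lspan_gen x : A x -> lspan x.
Proof. by move=> /(lspan_cons 1)/(_ lspan0); rewrite scale1r addr0. Qed.
Lemma lspanD x y : lspan x -> lspan y -> lspan (x + y).
Proof. by elim=> [|c {}x z Ax _ IH] sy; rewrite ?add0r // -addrA; apply: lspan_cons (IH sy). Qed.
Lemma lspanZ c x : lspan x -> lspan (c *: x).
Proof.
elim=> [|d {}x z Ax _ IH]; first by rewrite scaler0; apply: lspan0.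
by rewrite scalerDr scalerA; apply: lspan_cons.
Qed.
Lemma lspanN x : lspan x -> lspan (- x).
Proof. by rewrite -scaleN1r; apply: lspanZ. Qed.
Lemma lspan_sum I (r : seq I) (P : pred I) (f : I -> V) :
  (forall i, P i -> lspan (f i)) -> lspan (\sum_(i <- r | P i) f i).
Proof. by move=> h; apply: big_ind => //; [apply: lspan0 | apply: lspanD]. Qed.
End Span.

Lemma lspan_mono (R : pzRingType) (V : lmodType R) (A B : V -> Prop) :
  (forall x, A x -> B x) -> forall x, lspan A x -> lspan B x.
Proof. by move=> h x; elim=> [|c {}x y /h]; [apply: lspan0 | move=> ? _; apply: lspan_cons]. Qed.

Lemma lspan_linear (R : pzRingType) (V W : lmodType R) (f : {linear V -> W})
    (A : V -> Prop) (B : W -> Prop) :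
  (forall x, A x -> lspan B (f x)) -> forall x, lspan A x -> lspan B (f x).
Proof.
move=> h x; elim=> [|c {}x y /h fx _ IH]; first by rewrite linear0; apply: lspan0.
by rewrite linearP; apply: lspanD IH; apply: lspanZ.
Qed.

(** * Formal derivatives and the differential on the quotient *)

Section Operators.
Variable F : numClosedFieldType.
Implicit Types (g : gen) (x y : jetalg F).
Local Notation jet := (jet F).
Local Notation e k := (eta F k k).

Definition jetpar (b : bool) x : Prop := exists2 g, odd_fld g.1 = b & x = jet g.

Lemma jetpar_par b x : lspan (jetpar b) x -> parP x = (-1) ^+ b *: x.
Proof.
elim=> [|c {}x y [g <- ->] _ IH]; first by rewrite linear0 scaler0.
rewrite linearP /= IH parP_jet scalerDr !scalerA [c * _]mulrC; congr (_ *: _ + _).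
by rewrite /psign; case: ifP; rewrite ?expr1 ?expr0.
Qed.

Lemma jetpar_gcomm b b' x y : lspan (jetpar b) x -> lspan (jetpar b') y ->
  x * y = (-1) ^+ (b && b') *: (y * x).
Proof.
move=> hx hy; elim: hx => [|c {}x z [g gb ->] _ IH].
  by rewrite mul0r mulr0 scaler0.
rewrite mulrDl mulrDr scalerDr IH; congr (_ + _).
elim: hy {z IH} => [|d {}y z [g' gb' ->] _ IH].
  by rewrite mul0r mulr0 scaler0.
rewrite mulrDl mulrDr scalerDr IH; congr (_ + _).
rewrite -!scalerAl -!scalerAr jet_gcomm /gsign gb gb' !scalerA; congr (_ *: _).
by case: b {gb IH}; case: b' {gb'} => /=; rewrite ?expr1 ?expr0; ring.
Qed.

(** When [k] reverses parity, moving [k g] past [jet g'] costs [gsign g g'] times the parity sign of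
    [g'], which is what the twisted Leibniz rule asks for. Only the linear relations between jets
    then remain to be checked. *)
Lemma odd_der_gcomm (k : gen -> jetalg F) :
  (forall g, lspan (jetpar (~~ odd_fld g.1)) (k g)) ->
  forall g g', k g * jet g' + parP (jet g) * k g' =
    gsign F g g' *: (k g' * jet g + parP (jet g') * k g).
Proof.
move=> hk g g'.
have jp h : lspan (jetpar (odd_fld h.1)) (jet h) by apply: lspan_gen; exists h.
rewrite addrC scalerDr !parP_jet -!scalerAl !scalerA.
rewrite [k g' * _](jetpar_gcomm (hk g') (jp g)) [k g * _](jetpar_gcomm (hk g) (jp g')).
rewrite scalerA; congr (_ *: _ + _ *: _); rewrite /psign /gsign.
  by case: (odd_fld g.1); case: (odd_fld g'.1) => /=; rewrite ?expr1 ?expr0; ring.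
by case: (odd_fld g.1); case: (odd_fld g'.1) => /=; rewrite ?expr1 ?expr0; ring.
Qed.

Definition odd_derivation (D : {linear jetalg F -> jetalg F}) :=
  forall x y, D (x * y) = D x * y + parP x * D y.

Lemma odd_derivation_ext (k : gen -> jetalg F) :
  (forall g, lspan (jetpar (~~ odd_fld g.1)) (k g)) ->
  (forall f s s', perm_eq s s' -> k (f, s) = k (f, s')) ->
  (forall m n s, k (fH m n, s) = k (fH n m, s)) ->
  (forall f s, \sum_i e i *: k (f, i :: i :: s) = 0) ->
  {D : {linear jetalg F -> jetalg F} | (forall g, D (jet g) = k g) /\ odd_derivation D}.
Proof.
move=> hk h1 h2 h3.
by have [D [? ?]] := derivation_ext (alpha := @parP F) (beta := idfun)
  (odd_der_gcomm hk) h1 h2 h3; exists D.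
Qed.

Lemma odd_derivation1 D : odd_derivation D -> D 1 = 0.
Proof.
move=> /(_ 1 1); rewrite rmorph1 mul1r mulr1 mul1r => /eqP.
by rewrite addrC -subr_eq subrr eq_sym => /eqP.
Qed.

Lemma odd_derivation_par D : odd_derivation D ->
  (forall g, lspan (jetpar (~~ odd_fld g.1)) (D (jet g))) ->
  forall x, parP (D x) = - D (parP x).
Proof.
move=> hD hk; elim/jetalg_ind=> [g|c|x y hx hy|x y hx hy].
- rewrite (jetpar_par (hk g)) parP_jet linearZ /= -scaleNr /psign.
  by case: (odd_fld g.1); rewrite ?expr0 ?expr1 ?opprK.
- by rewrite 3!linearZ /= rmorph1 linearZ /= (odd_derivation1 hD) linear0 scaler0 oppr0.
- by rewrite !linearD /= hx hy.
- rewrite hD [parP (_ + _)]linearD /= !rmorphM /= hx hy hD opprD parPK mulNr mulrN.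
  by [].
Qed.

Definition dgen (m : 'I_4) g := jet (g.1, m :: g.2).

Lemma dP_sig m : {D : {linear jetalg F -> jetalg F} |
  (forall g, D (jet g) = dgen m g) /\ forall x y, D (x * y) = D x * y + x * D y}.
Proof.
apply: (derivation_ext (alpha := idfun) (beta := idfun)) => /=.
- move=> g g'; rewrite /dgen [X in X + _]jet_gcomm [X in _ + X]jet_gcomm addrC.
  by rewrite scalerDr /gsign.
- by move=> f s s' h; apply: jet_perm; rewrite perm_cons.
- by move=> *; apply: jet_hsym.
- move=> f s; rewrite -[RHS](jet_wave F f (m :: s)); apply: eq_bigr => i _; congr (_ *: _).
  exact/jet_perm/permEl/(perm_catCA [:: m] [:: i; i] s).
Qed.
Definition dP m := sval (dP_sig m).
Lemma dP_jet m f s : dP m (jet (f, s)) = jet (f, m :: s).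
Proof. exact: (proj1 (svalP (dP_sig m)) (f, s)). Qed.
Lemma dPD m x y : dP m (x + y) = dP m x + dP m y. Proof. exact: linearD. Qed.
Lemma dPB m x y : dP m (x - y) = dP m x - dP m y. Proof. exact: linearB. Qed.
Lemma dPZ m c x : dP m (c *: x) = c *: dP m x. Proof. exact: linearZ. Qed.
Lemma dP_sum m I (r : seq I) (P : pred I) (f : I -> jetalg F) :
  dP m (\sum_(i <- r | P i) f i) = \sum_(i <- r | P i) dP m (f i).
Proof. exact: linear_sum. Qed.
Lemma dPM m x y : dP m (x * y) = dP m x * y + x * dP m y.
Proof. exact: (proj2 (svalP (dP_sig m))). Qed.
Lemma dP1 m : dP m 1 = 0.
Proof. 
have /eqP := dPM m 1 1; rewrite mulr1 mulr1 mul1r.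
by rewrite addrC -subr_eq subrr eq_sym => /eqP.
Qed.

Lemma cls_dd m a : cls (dd m a) = dP m (cls a).
Proof.
elim: a => [[f s]|c|a ha b hb|a ha b hb] /=.
- by rewrite -[RHS]/(dP m (jet (f, s))) dP_jet.
- by rewrite [in RHS]clsC linearZ /= dP1 scaler0.
- by rewrite !clsD linearD /= ha hb.
- by rewrite clsD !clsM dPM ha hb.
Qed.

Lemma dPC m n x : dP m (dP n x) = dP n (dP m x).
Proof.
elim/jetalg_ind: x => [[f s]|c|x y hx hy|x y hx hy].
- rewrite !dP_jet; exact/jet_perm/permEl/(perm_catCA [:: m] [:: n] s).
- by rewrite !linearZ /= !dP1 !linear0.
- by rewrite !linearD /= hx hy.
- rewrite !(dPM, linearD) /= hx hy -!addrA; congr (_ + _).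
  by rewrite addrCA.
Qed.

Lemma parP_dP m x : parP (dP m x) = dP m (parP x).
Proof.
elim/jetalg_ind: x => [[f s]|c|x y hx hy|x y hx hy].
- by rewrite dP_jet !parP_jet linearZ /= dP_jet.
- by rewrite !linearZ /= rmorph1 dP1 linear0.
- by rewrite !linearD /= hx hy.
- by rewrite !(dPM, rmorphM, linearD) /= hx hy.
Qed.

Lemma dP_wave f s : \sum_k e k *: dP k (dP k (jet (f, s))) = 0.
Proof. by rewrite -[RHS](jet_wave F f s); apply: eq_bigr => k _; rewrite !dP_jet. Qed.

Definition Qgen g : jetalg F :=
  match g.1 with
  | fH m n => (- 'i / 2%:R) *: (dP m (jet (fU n, g.2)) + dP n (jet (fU m, g.2))
                - eta F m n *: \sum_r e r *: dP r (jet (fU r, g.2)))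
  | fU _ => 0
  | fUt m => 'i *: \sum_n e n *: dP n (jet (fH m n, g.2))
  end.

Lemma cls_dQgen g : cls (dQgen F g) = Qgen g.
Proof.
case: g => [[m n|m|m] s]; rewrite /dQgen /Qgen //= clsZ.
  rewrite !clsD clsZ cls_esum4 scaleNr !dP_jet; congr (_ *: (_ - _ *: _)).
  by apply: eq_bigr => r _; rewrite clsZ dP_jet.
rewrite cls_esum4; congr (_ *: _); apply: eq_bigr => r _; by rewrite clsZ dP_jet.
Qed.

Lemma eta_sym m n : eta F m n = eta F n m.
Proof. by rewrite /eta eq_sym; case: eqP => // ->. Qed.

Lemma QP_sig : {D : {linear jetalg F -> jetalg F} |
  (forall g, D (jet g) = Qgen g) /\ odd_derivation D}.
Proof.
apply: odd_derivation_ext.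
- move=> [[m n|m|m] s] /=; rewrite /Qgen /=; last first.
  + by apply/lspanZ/lspan_sum => i _; apply/lspanZ/lspan_gen; rewrite dP_jet; eexists; last by [].
  + exact: lspan0.
  + apply/lspanZ/lspanD; last apply/lspanN/lspanZ/lspan_sum => i _; rewrite ?dP_jet.
      by apply: lspanD; apply: lspan_gen; (eexists; last by []).
    by apply/lspanZ/lspan_gen; eexists; last by [].
- move=> f s s' h; rewrite /Qgen /=; have E f' := jet_perm F f' h.
  case: f => [m n|m|m] //; rewrite ?E; congr (_ *: _); last by apply: eq_bigr => i _; rewrite E.
  by rewrite ?(E (fU m)) ?(E (fU n)); congr (_ - _ *: _); apply: eq_bigr => i _; rewrite E.
- by move=> m n s; rewrite /Qgen /= eta_sym [X in _ *: (X - _)]addrC.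
- have wave m f s : \sum_i e i *: dP m (jet (f, [:: i, i & s])) = 0.
    rewrite -[RHS](linear0 (dP m)) -[in RHS](jet_wave F f s) linear_sum.
    by apply: eq_bigr => i _; rewrite linearZ.
  move=> [m n|m|m] s; rewrite /Qgen /=; last first.
  + under eq_bigr do rewrite scalerA mulrC -scalerA scaler_sumr.
    rewrite -scaler_sumr exchange_big /= big1 ?scaler0 // => i _.
    under eq_bigr do rewrite scalerA mulrC -scalerA.
    by rewrite -scaler_sumr wave scaler0.
  + by rewrite big1 // => i _; rewrite scaler0.
  + under eq_bigr do rewrite scalerA mulrC -scalerA.
    rewrite -scaler_sumr; under eq_bigr do rewrite !scalerDr.
    rewrite !big_split /= !wave !add0r.
    under eq_bigr do rewrite scalerN scalerA mulrC -scalerA scaler_sumr.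
    rewrite sumrN -scaler_sumr exchange_big /= big1 ?scaler0 ?oppr0 ?scaler0 // => i _.
    under eq_bigr do rewrite scalerA mulrC -scalerA.
    by rewrite -scaler_sumr wave scaler0.
Qed.
Definition QP := sval QP_sig.
Lemma QP_jet g : QP (jet g) = Qgen g.
Proof. exact: (proj1 (svalP QP_sig)). Qed.
Lemma QPM : odd_derivation QP.
Proof. exact: (proj2 (svalP QP_sig)). Qed.
Lemma QPD x y : QP (x + y) = QP x + QP y. Proof. exact: linearD. Qed.
Lemma QPB x y : QP (x - y) = QP x - QP y. Proof. exact: linearB. Qed.
Lemma QPZ c x : QP (c *: x) = c *: QP x. Proof. exact: linearZ. Qed.
Lemma QP_sum I (r : seq I) (P : pred I) (f : I -> jetalg F) :
  QP (\sum_(i <- r | P i) f i) = \sum_(i <- r | P i) QP (f i).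
Proof. exact: linear_sum. Qed.
Lemma QP1 : QP 1 = 0. Proof. exact/odd_derivation1/QPM. Qed.

Lemma cls_dQ a : cls (dQ a) = QP (cls a).
Proof.
elim: a => [g|c|a ha b hb|a ha b hb] /=.
- by rewrite -[RHS]/(QP (jet g)) QP_jet cls_dQgen.
- by rewrite [in RHS]clsC linearZ /= QP1 scaler0.
- by rewrite !clsD linearD /= ha hb.
- by rewrite clsD !clsM QPM ha hb parP_cls.
Qed.

Lemma Qgen_par g : lspan (jetpar (~~ odd_fld g.1)) (Qgen g).
Proof.
case: g => [[m n|m|m] s] /=; rewrite /Qgen /=; last first.
+ by apply/lspanZ/lspan_sum => i _; apply/lspanZ/lspan_gen; rewrite dP_jet; eexists; last by [].
+ exact: lspan0.
+ apply/lspanZ/lspanD; last apply/lspanN/lspanZ/lspan_sum => i _; rewrite ?dP_jet.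
    by apply: lspanD; apply: lspan_gen; (eexists; last by []).
  by apply/lspanZ/lspan_gen; eexists; last by [].
Qed.

Lemma parP_QP x : parP (QP x) = - QP (parP x).
Proof. by apply: odd_derivation_par QPM _ _ => g; rewrite QP_jet; apply: Qgen_par. Qed.

Lemma QP_dP m x : QP (dP m x) = dP m (QP x).
Proof.
elim/jetalg_ind: x => [[f s]|c|x y hx hy|x y hx hy].
- rewrite dP_jet !QP_jet; case: f => [k n|k|k]; rewrite /Qgen /= ?linear0 //.
    rewrite dPZ dPB dPD dPZ dP_sum -!dP_jet.
    congr (_ *: (_ + _ - _ *: _)); [exact: dPC | exact: dPC|].
    by apply: eq_bigr => r _; rewrite -dP_jet dPZ dPC.
  rewrite dPZ dP_sum; congr (_ *: _); apply: eq_bigr => r _.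
  by rewrite -dP_jet dPZ dPC.
- by rewrite !linearZ /= dP1 QP1 !linear0.
- by rewrite !linearD /= hx hy.
- rewrite !(dPM, QPM, linearD) /= hx hy parP_dP -!addrA; congr (_ + _).
  by rewrite addrCA.
Qed.

(** Only the anti-ghosts need an equation: the wave equation removes the d'Alembertian of [u_m], and
    the gradient of the divergence of [u] cancels against the trace term of [dQ h]. On products,
    [parP_QP] makes the cross terms cancel. *)
Lemma QPQP x : QP (QP x) = 0.
Proof.
elim/jetalg_ind: x => [[f s]|c|x y hx hy|x y hx hy].
- rewrite QP_jet; case: f => [m n|m|m]; rewrite /Qgen /= ?linear0 //.
    rewrite QPZ QPB QPD QPZ QP_sum.
    rewrite !QP_dP !QP_jet /Qgen /= !linear0 big1 ?scaler0 ?subr0 ?addr0 ?scaler0 // => r _.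
    by rewrite QPZ QP_dP QP_jet /Qgen linear0 scaler0.
  rewrite QPZ QP_sum.
  under eq_bigr => r _ do rewrite QPZ QP_dP QP_jet /Qgen /= dPZ scalerA [e r * _]mulrC -scalerA.
  rewrite -scaler_sumr.
  under [X in _ *: (_ *: X)]eq_bigr => r _ do rewrite dPB dPD dPZ scalerBr scalerDr.
  rewrite sumrB big_split /= dP_wave addr0.
  rewrite [X in _ - X](bigD1 m) //= [X in _ - (_ + X)]big1 => [|i im]; last first.
    by rewrite /eta [m == i]eq_sym (negbTE im) scale0r scaler0.
  rewrite addr0 [X in _ - X]scalerA dP_sum; set s1 := \sum_i _; set s2 := \sum_i _.
  have -> : s1 = s2.
    by apply: eq_bigr => i _; rewrite dPZ dPC.
  rewrite [e m * e m](_ : _ = 1) ?scale1r ?subrr ?scaler0 //.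
  by rewrite /eta eqxx; case: ifP; rewrite ?mulrNN mulr1.
- by rewrite !linearZ /= QP1 linear0 scaler0.
- by rewrite !linearD /= hx hy addr0.
- by rewrite !(QPM, linearD) /= hx hy parP_QP parPK mul0r mulr0 add0r addr0 mulNr addNr.
Qed.

End Operators.

(** * Homotopy *)

Section Homotopy.
Variable F : numClosedFieldType.
Implicit Types (g : gen) (x y t r : jetalg F).
Local Notation jet := (jet F).
Local Notation QP := (@QP F).
Variable K : {linear jetalg F -> jetalg F}.
Hypotheses (K_der : odd_derivation K) (K_par : forall x, parP (K x) = - K (parP x)).

Definition numop x := QP (K x) + K (QP x).

Arguments numop : simpl never.

Fact numop_linear : linear numop.
Proof.
move=> c x y; rewrite /numop [K (c *: x + y)]linearP [QP (c *: x + y)]linearP !linearP /=.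
by rewrite scalerDr addrACA.
Qed.
HB.instance Definition _ := GRing.isLinear.Build F _ _ _ numop numop_linear.

(** The anticommutator of two odd derivations is an even derivation: both anticommute with [parP],
    so the mixed terms cancel in pairs. *)
Lemma numopM x y : numop (x * y) = numop x * y + x * numop y.
Proof.
rewrite /numop K_der QPM QPD [K (_ + _)]linearD /= !K_der !QPM parP_QP K_par !parPK.
rewrite !mulNr !mulrDl !mulrDr.
rewrite addrACA [X in X + _]addrACA -opprD [X in _ + X]addrACA. 
by rewrite addrA [K _ * QP y + _]addrC subrK.
Qed.

(* [kill m r] says that (N - 1) ... (N - m) annihilates [r], where N = [numop]. *)
Fixpoint kill m r : Prop :=
  if m is m'.+1 then kill m' (numop r - m%:R *: r) else r = 0.

Lemma kill0 m : kill m 0.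
Proof. by elim: m => //= m IH; rewrite linear0 scaler0 subr0. Qed.
Lemma killP m c x y : kill m x -> kill m y -> kill m (c *: x + y).
Proof.
elim: m x y => [|m IH] x y /=; first by move=> -> ->; rewrite scaler0 addr0.
move=> hx hy; have := IH _ _ hx hy; congr kill.
rewrite [numop (_ + _)]linearP /= scalerBr [_.+1%:R *: (_ + _)]scalerDr !scalerA [c * _]mulrC.
by rewrite opprD addrACA.
Qed.
Lemma kill_numop m x : kill m x -> kill m (numop x).
Proof.
elim: m x => [|m IH] x /=; first by move=> ->; rewrite linear0.
by move=> /IH; rewrite linearB linearZ.
Qed.
Lemma killS m x : kill m x -> kill m.+1 x.
Proof.
move=> h; rewrite /= addrC -scaleNr; apply: killP => //; exact: kill_numop.
Qed.
Lemma kill_leq m n x : (m <= n)%N -> kill m x -> kill n x.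
Proof. by move=> /subnKC <-; elim: (n - m)%N => [|k IH] h; rewrite ?addn0 // addnS; apply/killS/IH. Qed.
Lemma kill_eigen j x : numop x = j.+1%:R *: x -> kill j.+1 x.
Proof. by move=> /= ->; rewrite subrr; apply: kill0. Qed.

(* Induction on [m]: if r' = N r - (m+1) r is exact, so is r, because N (t + r)
   = N r is exact. *)
Lemma kill_exact m t r : numop t = 0 -> kill m r -> QP (t + r) = 0 -> exists b, r = QP b.
Proof.
elim: m t r => [|m IH] t r /= ht; first by move=> -> _; exists 0; rewrite linear0.
move=> hr hq.
have Nr : numop r = QP (K (t + r)).
  have : numop (t + r) = QP (K (t + r)) by rewrite /numop hq linear0 addr0.
  by rewrite [numop (t + r)]linearD /= ht add0r.
have [] := IH (- m.+1%:R *: t) (numop r - m.+1%:R *: r).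
- by rewrite linearZ /= ht scaler0.
- by [].
- rewrite addrCA scaleNr -opprD -scalerDr Nr QPB QPQP sub0r QPZ hq scaler0 oppr0 //.
move=> b /eqP; rewrite subr_eq addrC -subr_eq => /eqP hb.
exists (m.+1%:R^-1 *: (K (t + r) - b)).
by rewrite QPZ QPB -Nr hb scalerA mulVf ?scale1r // pnatr_eq0.
Qed.

Variable T : jetalg F -> Prop.
Hypotheses (T_const : forall c, T (c *: 1)) (T_add : forall x y, T x -> T y -> T (x + y))
  (T_mul : forall x y, T x -> T y -> T (x * y)).

Definition eigen x := (exists j, numop x = j.+1%:R *: x) \/ (numop x = 0 /\ T x).

(** Eigenvalues add and are nonnegative, so a product falls in the zero case only when both factors
    do; hence membership in [T] can be asked for eigenvalue zero alone. *)
Lemma eigenM x y : eigen x -> eigen y -> eigen (x * y).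
Proof.
case=> [[i hi]|[hi Ti]] [[j hj]|[hj Tj]].
- left; exists (i + j.+1)%N; rewrite numopM hi hj -scalerAl -scalerAr -scalerDl -natrD.
  by congr (_%:R *: _); rewrite addSn.
- by left; exists i; rewrite numopM hi hj mulr0 addr0 -scalerAl.
- by left; exists j; rewrite numopM hi hj mul0r add0r -scalerAr.
- by right; split; [rewrite numopM hi hj mulr0 mul0r addr0 | apply: T_mul].
Qed.

Lemma span_eigenM x y : lspan eigen x -> lspan eigen y -> lspan eigen (x * y).
Proof.
move=> hx hy; elim: hx => [|c {}x z ex _ IH]; first by rewrite mul0r; apply: lspan0.
rewrite mulrDl -scalerAl; apply: lspanD IH; apply: lspanZ.
elim: hy => [|d {}y {}z ey _ IH]; first by rewrite mulr0; apply: lspan0.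
rewrite mulrDr -scalerAr; apply: lspanD IH; apply/lspanZ/lspan_gen; exact: eigenM.
Qed.

(** The nonzero eigenvalues need not be separated: [kill] is monotone in its bound, so their maximum
    serves for the whole remainder. *)
Lemma span_eigen_split x : lspan eigen x ->
  exists t m r, [/\ x = t + r, numop t = 0, T t & kill m r].
Proof.
elim=> [|c {}x y ex _ [t [m [r [-> ht Tt hr]]]]].
  exists 0, 0%N, 0; split; rewrite ?linear0 ?addr0 //.
  by have := T_const 0; rewrite scale0r.
case: ex => [[j hj]|[hx Tx]].
- exists t, (maxn j.+1 m), (c *: x + r); split=> //; first by rewrite addrCA.
  apply: killP; first exact: kill_leq (leq_maxl _ _) (kill_eigen hj).
  exact: kill_leq (leq_maxr _ _) hr.
- exists (c *: x + t), m, r; split=> //; first by rewrite addrA.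
    by rewrite linearP /= hx ht scaler0 addr0.
  apply: T_add => //; rewrite -[x]mul1r scalerAl; exact: T_mul.
Qed.

(** The contraction is effective only on jets up to some weight, so the argument is relative to a
    set [G] of admissible jets. *)
Fixpoint all_gens (G : gen -> Prop) (e : expr F) : Prop :=
  match e with
  | Var g => G g
  | Const _ => True
  | Add a b => all_gens G a /\ all_gens G b
  | Mul a b => all_gens G a /\ all_gens G b
  end.

Variable G : gen -> Prop.
Hypothesis G_split : forall g, G g ->
  exists w c, [/\ jet g = w + c, T w, numop w = 0 & numop c = c].

Lemma span_eigen_cls e : all_gens G e -> lspan eigen (cls e).
Proof.
elim: e => [g|c|a IHa b IHb|a IHa b IHb] /=.
- move=> /G_split [w [c [E Tw hw hc]]]; rewrite -[cls _]/(jet g) E.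
  apply: lspanD; apply: lspan_gen; first by right.
  by left; exists 0%N; rewrite scale1r.
- move=> _; rewrite clsC; apply: lspan_gen; right; split; last exact: T_const.
  by rewrite linearZ /= /numop QP1 (odd_derivation1 K_der) !linear0 addr0 scaler0.
- by move=> [/IHa ha /IHb hb]; rewrite clsD; apply: lspanD.
- by move=> [/IHa ha /IHb hb]; rewrite clsM; apply: span_eigenM.
Qed.

Theorem closed_cohomologous e : all_gens G e -> QP (cls e) = 0 ->
  exists t b, T t /\ cls e = t + QP b.
Proof.
move=> /span_eigen_cls/span_eigen_split [t [m [r [-> ht Tt hr]]]] h.
by have [b ->] := kill_exact ht hr h; exists t, b.
Qed.

End Homotopy.

(** * Contraction of the linear complex *)

Section LinearAlgebra.
Variable F : numFieldType.

(* The affine conditions on a pseudo-inverse [G] of [D] and on the projection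
   [rho] onto the image of [D] survive averaging over the involution [s], which
   makes them homogeneous. *)
Lemma odd_contraction r (D s W : 'M[F]_r) :
  D *m D = 0 -> s *m s = 1%:M -> s *m D = - (D *m s) -> (W *m s <= W)%MS ->
  (kermx D <= W + D)%MS ->
  exists K tau : 'M[F]_r,
    [/\ s *m K = - (K *m s), D *m K + K *m D = 1%:M - tau, (tau <= W)%MS & tau *m tau = tau].
Proof.
move=> DD ss sD Ws kD.
have half (A : 'M[F]_r) : 2^-1 *: (A + A) = A.
  by rewrite -mulr2n -scaler_nat scalerA mulVf ?scale1r // pnatr_eq0.
pose G0 := pinvmx D.
have DG0D : D *m G0 *m D = D by rewrite mulmxKpV.
pose G := 2^-1 *: (G0 - s *m G0 *m s).
have sDs : s *m D *m s = - D by rewrite sD mulNmx -mulmxA ss mulmx1.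
have Ds : D *m s = - (s *m D) by rewrite sD opprK.
have DGD : D *m G *m D = D.
  rewrite -scalemxAr -scalemxAl mulmxBr mulmxBl DG0D.
  have -> : D *m (s *m G0 *m s) *m D = - (s *m D) *m G0 *m - (D *m s).
    by rewrite -Ds -sD !mulmxA.
  rewrite mulmxN !mulNmx opprK.
  have -> : s *m D *m G0 *m (D *m s) = s *m (D *m G0 *m D) *m s by rewrite !mulmxA.
  by rewrite DG0D sDs opprK half.
have sG : s *m G = - (G *m s).
  rewrite -scalemxAr -scalemxAl mulmxBr mulmxBl !mulmxA ss mul1mx -!mulmxA ss mulmx1.
  by rewrite -scalerN opprB.
have sDG : s *m (D *m G) = D *m G *m s.
  by rewrite mulmxA sD mulNmx -!mulmxA sG mulmxN opprK.
pose U := 1%:M - D *m G.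
have sU : s *m U = U *m s by rewrite mulmxBr mulmxBl mulmx1 mul1mx sDG.
have UD : U *m D = 0 by rewrite mulmxBl mul1mx DGD subrr.
have DU : D *m U = D by rewrite mulmxBr mulmx1 mulmxA DD mul0mx subr0.
have DGU : D *m G *m U = 0 by rewrite mulmxBr mulmx1 !mulmxA DGD subrr.
pose W0 := ((W :&: kermx D) :\: D)%MS.
have W0W : (W0 <= W)%MS by apply: submx_trans (diffmxSl _ _) (capmxSl _ _).
have DW0 : (D :&: W0 = 0)%MS by rewrite capmxC capmx_diff.
have UW0 : (U <= D + W0)%MS.
  have /submx_trans -> // : (U <= kermx D)%MS by apply/sub_kermxP.
  have DkD : (D <= kermx D)%MS by apply/sub_kermxP.
  have : (kermx D <= D + (W :&: kermx D))%MS.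
    by rewrite (matrix_modl W DkD) sub_capmx submx_refl andbT addsmxC.
  move=> /submx_trans -> //; rewrite addsmx_sub addsmxSl /=.
  rewrite -(addsmx_diff_cap_eq (W :&: kermx D)%MS D) addsmx_sub addsmxSr /=.
  exact: submx_trans (capmxSr _ _) (addsmxSl _ _).
pose rho0 := U *m proj_mx D W0.
have rho0D : (rho0 <= D)%MS by apply: proj_mx_sub.
have tau0W : (U - rho0 <= W)%MS by apply: submx_trans W0W; apply: proj_mx_compl_sub.
have Drho0 : D *m rho0 = D by rewrite mulmxA DU proj_mx_id.
have DGrho0 : D *m G *m rho0 = 0 by rewrite mulmxA DGU mul0mx.
clearbody rho0.
pose rho := 2^-1 *: (rho0 + s *m rho0 *m s).
have srho : s *m rho = rho *m s.
  rewrite -scalemxAr -scalemxAl mulmxDr mulmxDl !mulmxA ss mul1mx -!mulmxA ss mulmx1.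
  by rewrite addrC.
have rhoD : (rho <= D)%MS.
  apply: scalemx_sub; apply: addmx_sub => //.
  rewrite -mulmxA; apply: submx_trans (submxMl _ _) _.
  apply: submx_trans (submxMr s rho0D) _.
  by rewrite Ds eqmx_opp submxMl.
have Drho : D *m rho = D.
  have e : D *m (s *m rho0 *m s) = D.
    by rewrite !mulmxA Ds !mulNmx -[s *m D *m rho0]mulmxA Drho0 sDs opprK.
  by rewrite -scalemxAr mulmxDr Drho0 e half.
have DGrho : D *m G *m rho = 0.
  by rewrite -scalemxAr mulmxDr !mulmxA DGrho0 -sDG -[_ *m rho0]mulmxA DGrho0 mulmx0 mul0mx addr0 scaler0.
pose tau := U - rho.
have tauW : (tau <= W)%MS.
  have -> : tau = 2^-1 *: ((U - rho0) + s *m (U - rho0) *m s).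
    rewrite mulmxBr mulmxBl sU -!mulmxA ss mulmx1 addrACA -opprD scalerBr half.
    by rewrite /tau /rho mulmxA.
  apply: scalemx_sub; apply: addmx_sub => //.
  rewrite -mulmxA; apply: submx_trans (submxMl _ _) _.
  exact: submx_trans (submxMr s tau0W) Ws.
have /submxP [X rhoX] := rhoD.
have rhoGD : rho *m G *m D = rho by rewrite rhoX -!mulmxA [D *m _]mulmxA DGD.
have rhoD0 : rho *m D = 0 by rewrite rhoX -mulmxA DD mulmx0.
have rhorho : rho *m rho = rho by rewrite {1}rhoX -mulmxA Drho -rhoX.
(* [K] projects to the image of [D] and then inverts [D] there: [DK = DG] and [KD = rho], with sum
   [1 - (U - rho)]. *)
exists (rho *m G), tau; split=> //.
- by rewrite mulmxA srho -!mulmxA sG mulmxN.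
- by rewrite rhoGD mulmxA Drho /tau /U opprB opprB addrCA [1%:M + _]addrC subrK addrC.
- have tD : tau *m D = 0 by rewrite mulmxBl UD rhoD0 subrr.
  have tr : tau *m rho = 0 by rewrite mulmxBl mulmxBl mul1mx DGrho rhorho subr0 subrr.
  by rewrite {2}/tau mulmxBr tr subr0 mulmxBr mulmx1 mulmxA tD mul0mx subr0.
Qed.

(** [S] is an arbitrary predicate: a missing vector is adjoined as long as there is one, and [k]
    bounds the remaining codimension. *)
Lemma subspace_mx r (S : 'rV[F]_r -> Prop) :
  S 0 -> (forall c u v, S u -> S v -> S (c *: u + v)) ->
  exists W : 'M[F]_r, forall v, (v <= W)%MS <-> S v.
Proof.
move=> S0 Slin.
suff H k (W : 'M[F]_r) : (forall v : 'rV_r, (v <= W)%MS -> S v) -> (r - \rank W <= k)%N ->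
    exists W : 'M[F]_r, forall v, (v <= W)%MS <-> S v.
  apply: (H r 0); last exact: leq_subr.
  by move=> v; rewrite submx0 => /eqP ->.
elim: k W => [|k IH] W hW rk.
  exists W => v; split; first exact: hW.
  move=> _; apply: submx_full; rewrite /row_full eqn_leq rank_leq_col.
  by rewrite -subn_eq0 -leqn0.
have [[v [Sv vW]]|hn] := excluded_middle_informative (exists v, S v /\ ~ (v <= W)%MS).
  apply: (IH (W + v)%MS).
    move=> w /sub_addsmxP [[a b] /= ->]; rewrite addrC.
    rewrite [b]mx11_scalar mul_scalar_mx; apply: Slin => //; apply: hW; exact: submxMl.
  have lt : (\rank W < \rank (W + v)%MS)%N.
    rewrite ltn_neqAle mxrankS ?addsmxSl // andbT; apply/negP => e.
    apply: vW; apply: submx_trans (addsmxSr W v) _.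
    by rewrite -(mxrank_leqif_sup (addsmxSl W v)).
  move: rk lt (rank_leq_col (W + v)%MS); set p := \rank W; set q := \rank _.
  by rewrite !leq_subLR => h1 h2 h3; apply: leq_trans h1 _; rewrite addnS -addSn leq_add2r.
exists W => v; split=> [|Sv]; first exact: hW.
by have [//|nvW] := boolP (v <= W)%MS; case: hn; exists v; split=> //; apply/negP.
Qed.

(** Extracts a basis from a finite list of possibly dependent vectors; applied to jets, it replaces
    a choice of normal forms. *)
Lemma free_subseq (V : lmodType F) (I : eqType) (f : I -> V) (l : seq I) :
  exists h : seq I, [/\ {subset h <= l},
    forall c : 'rV[F]_(size h), \sum_k c 0 k *: f (tnth (in_tuple h) k) = 0 -> c = 0 &
    forall i, i \in l -> exists c : 'rV[F]_(size h), f i = \sum_k c 0 k *: f (tnth (in_tuple h) k)].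
Proof.
elim: l => [|a l [h [sub fr sp]]].
  by exists [::]; split=> // c _; apply/rowP => -[].
have [[c hc]|hn] := excluded_middle_informative
    (exists c : 'rV[F]_(size h), f a = \sum_k c 0 k *: f (tnth (in_tuple h) k)).
  exists h; split=> // [i /sub|i]; first by rewrite inE orbC => ->.
  by rewrite inE => /orP [/eqP ->|/sp //]; exists c.
have E (c : 'rV[F]_(size (a :: h))) :
    \sum_k c 0 k *: f (tnth (in_tuple (a :: h)) k) =
    c 0 ord0 *: f a + \sum_k c 0 (lift ord0 k) *: f (tnth (in_tuple h) k).
  rewrite big_ord_recl; congr (_ *: f _ + _); apply: eq_bigr => k _.
  by congr (_ *: f _); rewrite !(tnth_nth a).
exists (a :: h); split.
- by move=> i; rewrite !inE => /orP [->//|/sub ->]; rewrite orbT.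
- move=> c; rewrite E => hc.
  have c0 : c 0 ord0 = 0.
    apply/eqP/negPn/negP => c0; apply: hn.
    exists (\row_k (- (c 0 ord0)^-1 * c 0 (lift ord0 k))).
    under eq_bigr do rewrite mxE -scalerA.
    rewrite -scaler_sumr; move/eqP: hc; rewrite addr_eq0 -eqr_oppLR => /eqP <-.
    by rewrite scalerN scaleNr opprK scalerA mulVf // scale1r.
  rewrite c0 scale0r add0r in hc.
  have := fr (\row_k c 0 (lift ord0 k)).
  under eq_bigr do rewrite mxE; move=> /(_ hc)/rowP h0.
  apply/rowP => k; rewrite [RHS]mxE; case: (unliftP ord0 k) => [j ->|-> //].
  by have := h0 j; rewrite !mxE.
- move=> i; rewrite inE => /orP [/eqP ->|/sp [c hc]].
    exists (\row_k (k == ord0)%:R); rewrite E mxE eqxx scale1r big1 ?addr0 // => k _.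
    by rewrite mxE /= scale0r.
  exists (\row_k if unlift ord0 k is Some j then c 0 j else 0).
  rewrite E mxE unlift_none scale0r add0r hc; apply: eq_bigr => k _.
  by rewrite mxE liftK.
Qed.

End LinearAlgebra.

(** * Truncation of the linear complex by weight *)

Section Contraction.
Variable F : numClosedFieldType.
Implicit Types (g : gen) (x y : jetalg F).
Local Notation jet := (jet F).
Local Notation QP := (@QP F).

(* Number of derivatives, shifted so that [QP] preserves it. *)
Definition wt g : nat :=
  size g.2 + match g.1 with fH _ _ => 1 | fU _ => 0 | fUt _ => 2 end.

Definition jetbw b w x : Prop := exists g, [/\ odd_fld g.1 = b, wt g = w & x = jet g].

Lemma jetbw_par b w x : lspan (jetbw b w) x -> lspan (jetpar b) x.
Proof. by apply: lspan_mono => y [g [h1 _ h2]]; exists g. Qed.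

Lemma Qgen_bw g : lspan (jetbw (~~ odd_fld g.1) (wt g)) (QP (jet g)).
Proof.
rewrite QP_jet; case: g => [[m n|m|m] s] /=; rewrite /Qgen /=; last first.
+ apply/lspanZ/lspan_sum => i _; apply/lspanZ/lspan_gen; rewrite dP_jet; exists (fH m i, i :: s); split=> //.
  by rewrite /wt /= addSnnS.
+ exact: lspan0.
+ have h f : (exists k, f = fU k) -> forall k, lspan (jetbw true (wt (fH m n, s))) (dP F k (jet (f, s))).
    move=> [k' ->] k; apply: lspan_gen; rewrite dP_jet; exists (fU k', k :: s); split=> //.
    by rewrite /wt /= addSnnS.
  apply/lspanZ/lspanD; last apply/lspanN/lspanZ/lspan_sum => i _; last apply: lspanZ.
    by apply: lspanD; apply: h; eexists.
  by apply: h; eexists.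
Qed.

Section LinearPart.
Variable m : nat.

(** The augmentation with values in the algebra itself, so that it can twist a derivation from [P]
    to [P]. *)
Definition eps x : jetalg F := augP x *: 1.
Fact eps_linear : linear eps.
Proof. by move=> c x y; rewrite /eps linearP scalerDl -scalerA. Qed.
HB.instance Definition _ := GRing.isLinear.Build F _ _ _ eps eps_linear.
Fact eps_monoid : monoid_morphism eps.
Proof.
split=> [|x y]; first by rewrite /eps rmorph1 scale1r.
by rewrite /eps rmorphM -scalerAl mul1r scalerA.
Qed.
HB.instance Definition _ := GRing.isMonoidMorphism.Build _ _ eps eps_monoid.

Lemma eps_jet g : eps (jet g) = 0.
Proof. by rewrite /eps augP_jet scale0r. Qed.
Lemma eps_par x : eps (parP x) = eps x.
Proof.
elim/jetalg_ind: x => [g|c|x y hx hy|x y hx hy].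
- by rewrite parP_jet linearZ /= eps_jet scaler0.
- by rewrite linearZ /= rmorph1.
- by rewrite !linearD /= hx hy.
- by rewrite !rmorphM /= hx hy.
Qed.
Lemma eps_span b w x : lspan (jetbw b w) x -> eps x = 0.
Proof. by elim=> [|c {}x y [g [_ _ ->]] _ IH]; rewrite ?linear0 // linearP /= eps_jet IH scaler0 addr0. Qed.
Lemma eps_QP x : eps (QP x) = 0.
Proof.
elim/jetalg_ind: x => [g|c|x y hx hy|x y hx hy].
- exact: eps_span (Qgen_bw g).
- by rewrite QPZ QP1 scaler0 linear0.
- by rewrite QPD linearD /= hx hy addr0.
- by rewrite QPM linearD /= !rmorphM /= hx hy mul0r mulr0 addr0.
Qed.

Definition lgen g : jetalg F := if (wt g <= m)%N then jet g else 0.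

(** A derivation twisted by the augmentation on both sides vanishes on products of jets, hence
    projects onto the linear part. Cutting at weight [m] is consistent because every relation
    between jets is homogeneous for [wt]. *)
Lemma linpart_sig : {D : {linear jetalg F -> jetalg F} |
  (forall g, D (jet g) = lgen g) /\ forall x y, D (x * y) = D x * eps y + eps x * D y}.
Proof.
apply: (derivation_ext (alpha := eps) (beta := eps)) => /=.
- by move=> g g'; rewrite !eps_jet !mulr0 !mul0r !addr0 scaler0.
- by move=> f s s' h; rewrite /lgen /wt /= (perm_size h) (jet_perm F f h).
- by move=> *; rewrite /lgen /wt /= jet_hsym.
- move=> f s; have w i : wt (f, [:: i, i & s]) = wt (f, [:: ord0, ord0 & s]) by [].
  under eq_bigr do rewrite /lgen w.
  case: (_ <= m)%N; first exact: jet_wave.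
  by rewrite big1 // => i _; rewrite scaler0.
Qed.
Definition linpart := sval linpart_sig.
Lemma linpart_jet g : linpart (jet g) = lgen g.
Proof. exact: (proj1 (svalP linpart_sig)). Qed.
Lemma linpartM x y : linpart (x * y) = linpart x * eps y + eps x * linpart y.
Proof. exact: (proj2 (svalP linpart_sig)). Qed.
Lemma linpart1 : linpart 1 = 0.
Proof.
have /eqP := linpartM 1 1; rewrite rmorph1 !mulr1 mul1r.
by rewrite addrC -subr_eq subrr eq_sym => /eqP.
Qed.

Lemma linpart_bw b w x : lspan (jetbw b w) x -> linpart x = if (w <= m)%N then x else 0.
Proof.
elim=> [|c {}x y [g [_ <- ->]] _ IH]; first by rewrite linear0; case: ifP.
by rewrite linearP /= linpart_jet IH /lgen; case: ifP; rewrite // scaler0 addr0.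
Qed.

Lemma linpart_QP x : linpart (QP x) = QP (linpart x).
Proof.
elim/jetalg_ind: x => [g|c|x y hx hy|x y hx hy].
- rewrite (linpart_bw (Qgen_bw g)) linpart_jet /lgen; case: ifP => // _.
  by rewrite linear0.
- by rewrite QPZ QP1 !scaler0 linear0 linearZ /= linpart1 scaler0 linear0.
- by rewrite QPD !linearD /= hx hy ?QPD.
- rewrite QPM linearD /= !linpartM !eps_QP eps_par hx hy mul0r mulr0 addr0 add0r.
  by rewrite QPD /eps -!scalerAr -!scalerAl !mulr1 !mul1r !QPZ.
Qed.

Definition Vm : jetalg F -> Prop := lspan (fun x => exists2 g, (wt g <= m)%N & x = jet g).

Lemma Vm_jet g : (wt g <= m)%N -> Vm (jet g).
Proof. by move=> h; apply: lspan_gen; exists g. Qed.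

Lemma Vm_linpart x : Vm (linpart x).
Proof.
elim/jetalg_ind: x => [g|c|x y hx hy|x y hx hy].
- by rewrite linpart_jet /lgen; case: ifP => h; [apply: Vm_jet | apply: lspan0].
- by rewrite linearZ /= linpart1 scaler0; apply: lspan0.
- by rewrite linearD; apply: lspanD.
- rewrite linpartM /eps -scalerAr -scalerAl mulr1 mul1r.
  by apply: lspanD; apply: lspanZ.
Qed.

Lemma linpart_Vm x : Vm x -> linpart x = x.
Proof.
elim=> [|c {}x y [g h ->] _ IH]; first exact: linear0.
by rewrite linearP /= linpart_jet /lgen h IH.
Qed.

Lemma gens_upto : exists l : seq gen, forall g, (g \in l) = (wt g <= m)%N.
Proof.
pose fs := [seq fld_decode c | c <- enum {: ('I_4 * 'I_4) + ('I_4 + 'I_4)}].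
pose ss := flatten [seq [seq val t | t <- enum {: n.-tuple 'I_4}] | n <- iota 0 m.+1].
exists [seq g <- [seq (f, s) | f <- fs, s <- ss] | (wt g <= m)%N] => g.
rewrite mem_filter andb_idr // => h; case: g h => f s h; apply/allpairsP.
exists (f, s); split=> //=.
  by rewrite -(fld_codeK f); apply: map_f; rewrite mem_enum.
apply/flatten_mapP; exists (size s).
  by rewrite mem_iota /= ltnS; apply: leq_trans h; apply: leq_addr.
by apply/mapP; exists (in_tuple s); rewrite ?mem_enum.
Qed.

End LinearPart.

Variable TG : jetalg F -> Prop.
Hypothesis TG_bw : forall t, TG t -> exists b w, lspan (jetbw b w) t.
Hypothesis TG_complete : forall x, lspan (fun y => exists g, y = jet g) x -> QP x = 0 ->
  exists w b, lspan TG w /\ x = w + QP b.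

Lemma TS_par x : lspan TG x -> lspan TG (parP x).
Proof.
apply: (lspan_linear (f := @parP F)) => t ht /=; have [b [w /jetbw_par/jetpar_par ->]] := TG_bw ht.
exact/lspanZ/lspan_gen.
Qed.
Lemma TS_linpart m x : lspan TG x -> lspan TG (linpart m x).
Proof.
apply: lspan_linear => t ht; have [b [w /linpart_bw ->]] := TG_bw ht.
by case: ifP => _; [apply: lspan_gen | apply: lspan0].
Qed.

(** The primitive given by [TG_complete] may be nonlinear and of any weight; [linpart], which
    commutes with [QP] and preserves the span of [TG], brings everything into [Vm]. *)
Lemma TG_complete_upto m x : Vm m x -> QP x = 0 ->
  exists w b, [/\ lspan TG w, Vm m w, Vm m b & x = w + QP b].
Proof.
move=> hx Qx; have [||w [b [Tw E]]] := TG_complete (x := x) => //.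
  by apply: lspan_mono hx => y [g _ ->]; exists g.
exists (linpart m w), (linpart m b); split; try exact: Vm_linpart; first exact: TS_linpart.
by rewrite -linpart_QP -linearD -E linpart_Vm.
Qed.

Section Coordinates.
Variables (m r : nat) (Y : 'I_r -> gen).
Hypotheses (Y_wt : forall k, (wt (Y k) <= m)%N)
  (Y_free : forall c : 'rV[F]_r, \sum_k c 0 k *: jet (Y k) = 0 -> c = 0)
  (Y_span : forall g, (wt g <= m)%N -> exists c : 'rV[F]_r, jet g = \sum_k c 0 k *: jet (Y k)).

Definition row_jet (v : 'rV[F]_r) : jetalg F := \sum_k v 0 k *: jet (Y k).
Fact row_jet_linear : linear row_jet.
Proof.
move=> c u v; rewrite /row_jet scaler_sumr -big_split; apply: eq_bigr => k _.
by rewrite !mxE scalerDl scalerA.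
Qed.
HB.instance Definition _ := GRing.isLinear.Build F _ _ _ row_jet row_jet_linear.

Lemma row_jet_inj : injective row_jet.
Proof.
move=> u v h; apply/eqP; rewrite -subr_eq0; apply/eqP/Y_free.
by rewrite -[LHS]/(row_jet (u - v)) linearB /= h subrr.
Qed.
Lemma row_jet_Vm v : Vm m (row_jet v).
Proof. by apply: lspan_sum => k _; apply/lspanZ/Vm_jet. Qed.
Lemma Vm_iota x : Vm m x -> exists v, x = row_jet v.
Proof.
elim=> [|c {}x y [g /Y_span [u hu] ->] _ [v ->]]; first by exists 0; rewrite linear0.
by exists (c *: u + v); rewrite linearP /= hu.
Qed.
Lemma row_jet_mul (v : 'rV[F]_r) (A : 'M[F]_r) : row_jet (v *m A) = \sum_k v 0 k *: row_jet (row k A).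
Proof.
rewrite mulmx_sum_row linear_sum; apply: eq_bigr => k _; exact: linearZ.
Qed.
Lemma mx_ext (A B : 'M[F]_r) : (forall v : 'rV_r, row_jet (v *m A) = row_jet (v *m B)) -> A = B.
Proof. by move=> h; apply/row_matrixP => k; rewrite !rowE; apply/row_jet_inj/h. Qed.

Lemma linear_mx (f : {linear jetalg F -> jetalg F}) : (forall k, Vm m (f (jet (Y k)))) ->
  exists A : 'M[F]_r, forall v, f (row_jet v) = row_jet (v *m A).
Proof.
move=> h; have /fin_all_exists [a ha] k : exists u, f (jet (Y k)) = row_jet u by apply: Vm_iota.
exists (\matrix_k a k) => v; rewrite row_jet_mul linear_sum; apply: eq_bigr => k _.
by rewrite linearZ /= ha rowK.
Qed.

Lemma row_jet_jetpar (b : bool) v : parP (row_jet v) = (-1) ^+ b *: row_jet v -> lspan (jetpar b) (row_jet v).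
Proof.
(* The projector onto parity [b] fixes this vector and annihilates the jets of the other parity. *)
move=> h; have -> : row_jet v = 2^-1 *: (row_jet v + (-1) ^+ b *: parP (row_jet v)).
  rewrite h scalerA -expr2 -exprM mulnC exprM sqrrN !expr1n scale1r -mulr2n.
  by rewrite -scaler_nat scalerA mulVf ?scale1r // pnatr_eq0.
apply: lspanZ; rewrite linear_sum scaler_sumr -big_split; apply: lspan_sum => k _ /=.
rewrite linearZ /= parP_jet scalerA [_ * v 0 k]mulrC -!scalerA -scalerDr; apply: lspanZ.
rewrite scalerA -[X in X + _]scale1r -scalerDl /psign.
have [e|] := eqVneq (odd_fld (Y k).1) b; first by apply/lspanZ/lspan_gen; exists (Y k).
case: (odd_fld _); case: b {h} => // _; rewrite ?expr0 ?expr1 ?mul1r ?mulr1 subrr scale0r;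
  exact: lspan0.
Qed.

Definition coord (x : jetalg F) : 'rV[F]_r := epsilon (inhabits 0) (fun c => x = row_jet c).
Lemma coordK x : Vm m x -> row_jet (coord x) = x.
Proof. by move=> /Vm_iota h; rewrite -(epsilon_spec (inhabits 0) _ h). Qed.

Lemma contraction_exists : exists K : {linear jetalg F -> jetalg F},
  [/\ odd_derivation K, forall x, parP (K x) = - K (parP x) &
   forall g, (wt g <= m)%N ->
     exists w c, [/\ jet g = w + c, lspan TG w, numop K w = 0 & numop K c = c]].
Proof.
have [D hD] : exists D : 'M[F]_r, forall v, QP (row_jet v) = row_jet (v *m D).
  apply: linear_mx => k; apply: lspan_mono (Qgen_bw (Y k)) => x [g [_ h ->]].
  by exists g => //; rewrite h.
have [s hs] : exists s : 'M[F]_r, forall v, parP (row_jet v) = row_jet (v *m s).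
  apply: (linear_mx (f := @parP F)) => k; rewrite /= parP_jet.
  by apply/lspanZ/Vm_jet/Y_wt.
have [W hW] : exists W : 'M[F]_r, forall v, (v <= W)%MS <-> lspan TG (row_jet v).
  apply: subspace_mx => [|c u v hu hv]; first by rewrite linear0; apply: lspan0.
  by rewrite linearP; apply: lspanD => //; apply: lspanZ.
have DD : D *m D = 0.
  by apply: mx_ext => v; rewrite mulmxA -!hD QPQP mulmx0 linear0.
have ss : s *m s = 1%:M by apply: mx_ext => v; rewrite mulmxA -!hs parPK mulmx1.
have sD : s *m D = - (D *m s).
  by apply: mx_ext => v; rewrite mulmxN [RHS]linearN !mulmxA /= -(hD (v *m s)) -!hs -hD parP_QP opprK.
have Ws : (W *m s <= W)%MS.
  apply/row_subP => k; rewrite row_mul; apply/hW; rewrite -hs; apply/TS_par/hW.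
  exact: row_sub.
(* Completeness of the targets says that the cohomology of the matrix [D] is represented in [W]. *)
have kD : (kermx D <= W + D)%MS.
  apply/row_subP => k; set z := row k _.
  have vD : z *m D = 0 by apply/sub_kermxP/row_sub.
  have [||w [b [Tw Vw Vb E]]] := @TG_complete_upto m (row_jet z).
  - exact: row_jet_Vm.
  - by rewrite hD vD linear0.
  have [w' Ew] := Vm_iota Vw; have [b' Eb] := Vm_iota Vb.
  have -> : z = w' + b' *m D by apply: row_jet_inj; rewrite linearD /= -hD -Ew -Eb.
  by rewrite addmx_sub_adds ?submxMl //; apply/hW; rewrite -Ew.
have [K [tau [sK DKKD tauW tautau]]] := odd_contraction DD ss sD Ws kD.
(* The value 0 above weight [m] is consistent, since every relation between jets relates jets of a
   single weight. *)
pose kK g := if (wt g <= m)%N then row_jet (coord (jet g) *m K) else 0.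
have kK_par g : lspan (jetpar (~~ odd_fld g.1)) (kK g).
  rewrite /kK; case: ifP => hg; last exact: lspan0.
  (* [K] anticommutes with the matrix [s] of the parity, so it flips the sign by which the parity
     acts. *)
  apply: row_jet_jetpar; rewrite hs -mulmxA -[K *m s]opprK -sK mulmxN linearN /= mulmxA.
  have -> : coord (jet g) *m s = psign F g *: coord (jet g).
    by apply: row_jet_inj; rewrite -hs linearZ /= coordK ?parP_jet //; apply: Vm_jet.
  rewrite -scalemxAl linearZ /= -scaleNr /psign.
  by case: (odd_fld _); rewrite /= ?expr1 ?expr0 ?opprK.
have [||||KP [hK K_der]] := @odd_derivation_ext F kK.
- exact: kK_par.
- by move=> f t t' h; rewrite /kK /wt /= (perm_size h) (jet_perm F f h).
- by move=> a b t; rewrite /kK /wt /= jet_hsym.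
- move=> f t; have w i : wt (f, [:: i, i & t]) = wt (f, [:: ord0, ord0 & t]) by [].
  under eq_bigr do rewrite /kK w.
  have [h|_] := boolP (wt (f, [:: ord0, ord0 & t]) <= m)%N; last by rewrite big1 // => i _; rewrite scaler0.
  have e0 : \sum_i eta F i i *: coord (jet (f, [:: i, i & t])) = 0.
    apply: row_jet_inj; rewrite linear_sum linear0 /= -[RHS](jet_wave F f t).
    by apply: eq_bigr => i _; rewrite linearZ /= coordK //; apply: Vm_jet.
  rewrite -[RHS](linear0 row_jet) -(mul0mx _ K) -e0 mulmx_suml linear_sum.
  by apply: eq_bigr => i _; rewrite -scalemxAl linearZ.
have KPi v : KP (row_jet v) = row_jet (v *m K).
  have e : v = \sum_k v 0 k *: coord (jet (Y k)).
    apply: row_jet_inj; rewrite linear_sum; apply: eq_bigr => k _.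
    by rewrite linearZ /= coordK //; apply: Vm_jet.
  rewrite [in RHS]e mulmx_suml !linear_sum; apply: eq_bigr => k _.
  by rewrite linearZ /= hK /kK Y_wt -scalemxAl linearZ.
have nK v : numop KP (row_jet v) = row_jet (v - v *m tau).
  by rewrite /numop KPi !hD KPi -linearD /= -!mulmxA -mulmxDr addrC DKKD mulmxBr mulmx1.
exists KP; split=> // [x|g hg].
  apply: odd_derivation_par K_der _ _ => g; rewrite hK.
  by apply: kK_par.
have [v ->] := Vm_iota (Vm_jet hg).
exists (row_jet (v *m tau)), (row_jet (v - v *m tau)); split.
- by rewrite -linearD /= addrC subrK.
- by apply/hW; apply: submx_trans (submxMl _ _) tauW.
- by rewrite nK -mulmxA tautau subrr linear0.
- by rewrite nK mulmxBl -mulmxA tautau subrr subr0.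
Qed.
End Coordinates.

Fixpoint maxwt (e : expr F) : nat :=
  match e with
  | Var g => wt g
  | Const _ => 0
  | Add a b => maxn (maxwt a) (maxwt b)
  | Mul a b => maxn (maxwt a) (maxwt b)
  end.

Lemma all_gens_maxwt e n : (maxwt e <= n)%N -> all_gens (fun g => wt g <= n)%N e.
Proof. by elim: e => //= a ha b hb; rewrite geq_max => /andP [/ha ? /hb ?]. Qed.

Variable T : jetalg F -> Prop.
Hypotheses (T_const : forall c, T (c *: 1)) (T_add : forall x y, T x -> T y -> T (x + y))
  (T_mul : forall x y, T x -> T y -> T (x * y)) (T_TG : forall x, TG x -> T x).

(** The weight bound is read off the syntax of [e]. It is a maximum over products as well, because
    only the individual jets have to lie in the range of the contraction. *)
Theorem closed_cohomologous_of_linear e : QP (cls e) = 0 ->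
  exists t b, T t /\ cls e = t + QP b.
Proof.
move=> he; set m := maxwt e.
have [l hl] := gens_upto m.
have [h [hsub hfree hspan]] := free_subseq jet l.
have [||| K [K_der K_par K_split]] :=
  @contraction_exists m (size h) (fun k => tnth (in_tuple h) k).
- by move=> k; rewrite -hl; apply/hsub/mem_tnth.
- exact: hfree.
- by move=> g; rewrite -hl; apply: hspan.
apply: (closed_cohomologous K_der K_par T_const T_add T_mul _ (all_gens_maxwt (leqnn _)) he).
move=> g /K_split [w [c [E Tw hw hc]]]; exists w, c; split=> //.
elim: Tw => [|d x y /T_TG Tx _ Ty]; first by have := T_const 0; rewrite scale0r.
by apply: T_add => //; rewrite -[x]mul1r scalerAl; apply: T_mul.
Qed.
End Contraction.

(** * Traceless parts *)

Section Orthogonal.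
Variable F : numClosedFieldType.

(** Each diagonal entry of the sum is a sum of squared norms. *)
Lemma sum_adjoint_eq0 (C : finType) n m (Y : C -> 'M[F]_(n, m)) :
  \sum_c (map_mx Num.conj (Y c))^T *m Y c = 0 -> forall c, Y c = 0.
Proof.
move=> h c; apply/matrixP => i j; rewrite [RHS]mxE.
have /matrixP/(_ j j) := h; rewrite summxE [RHS]mxE.
under eq_bigr => d _.
  rewrite mxE; under eq_bigr => k _ do rewrite !mxE mulrC -normCK.
  over.
move=> /eqP; rewrite psumr_eq0 => [|d _]; last by apply: sumr_ge0 => k _; rewrite exprn_ge0.
move=> /allP/(_ c (mem_index_enum _)) /=; rewrite psumr_eq0 => [|k _]; last by rewrite exprn_ge0.
move=> /allP/(_ i (mem_index_enum _)) /=; rewrite expf_eq0 /= normr_eq0.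
by move=> /eqP.
Qed.

Variables (C : finType) (n : nat) (E : C -> 'M[F]_n).
Hypotheses (E_sym : forall c, (E c)^T = E c) (E_real : forall c, map_mx Num.conj (E c) = E c).

Let Q := \sum_c E c *m E c.

Lemma Q_sym : Q^T = Q.
Proof. by rewrite raddf_sum; apply: eq_bigr => c _; rewrite /= trmx_mul E_sym. Qed.

Lemma Q_real : map_mx Num.conj Q = Q.
Proof. by rewrite raddf_sum; apply: eq_bigr => c _; rewrite /= map_mxM E_real. Qed.

(** Pairing [Q X = 0] with [X] gives a vanishing sum of squared norms of the [E c X], so each [E c]
    annihilates the kernel of [Q]. *)
Lemma E_factor c : exists B, E c = B *m Q.
Proof.
suff /submxP h : (E c <= Q)%MS by [].
rewrite submxE; apply/eqP; move: c; set X := cokermx Q; apply: sum_adjoint_eq0.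
transitivity ((map_mx Num.conj X)^T *m Q *m X); last by rewrite -mulmxA mulmx_coker mulmx0.
rewrite /Q mulmx_sumr mulmx_suml.
by apply: eq_bigr => c _; rewrite map_mxM trmx_mul E_real E_sym !mulmxA.
Qed.

(** [Q] is self-adjoint, so the squared norm of [Q X] is the pairing of [X] with [Q Q X]: squaring
    does not enlarge the kernel. *)
Lemma Q_factor : exists H, Q = H *m (Q *m Q).
Proof.
suff /submxP h : (Q <= Q *m Q)%MS by [].
rewrite submxE; apply/eqP; set X := cokermx _.
apply: (@sum_adjoint_eq0 'I_1 _ _ (fun _ => Q *m X) _ ord0).
rewrite big_ord1 map_mxM trmx_mul Q_real Q_sym -mulmxA [Q *m (Q *m X)]mulmxA.
by rewrite mulmx_coker mulmx0.
Qed.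

Variable V : lmodType F.
(** Tensor components lie in the jet algebra, so scalar matrices act on families with values in a
    module; the factorizations above then apply without coordinates on the values. *)
Definition act_mx (A : 'M[F]_n) (t : 'I_n -> V) (i : 'I_n) : V := \sum_j A i j *: t j.

Lemma eq_act A t t' : t =1 t' -> act_mx A t =1 act_mx A t'.
Proof. by move=> h i; apply: eq_bigr => j _; rewrite h. Qed.
Lemma act_mxM A B t i : act_mx (A *m B) t i = act_mx A (act_mx B t) i.
Proof.
rewrite /act_mx; under eq_bigr do rewrite mxE scaler_suml.
rewrite exchange_big; apply: eq_bigr => k _; rewrite scaler_sumr.
by apply: eq_bigr => j _; rewrite scalerA.
Qed.
Lemma act_mx_sub A t u i : act_mx A (fun j => t j - u j) i = act_mx A t i - act_mx A u i.
Proof. by rewrite -sumrB; apply: eq_bigr => j _; rewrite scalerBr. Qed.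
Lemma act_mx_sum A (y : C -> 'I_n -> V) i :
  act_mx A (fun j => \sum_c y c j) i = \sum_c act_mx A (y c) i.
Proof. by rewrite exchange_big; apply: eq_bigr => j _; rewrite scaler_sumr. Qed.
Lemma act_sum_mx (A : C -> 'M[F]_n) t i : act_mx (\sum_c A c) t i = \sum_c act_mx (A c) t i.
Proof.
rewrite exchange_big; apply: eq_bigr => j _; rewrite summxE scaler_suml.
by [].
Qed.
Lemma act_mx0 A t i : (forall j, t j = 0) -> act_mx A t i = 0.
Proof. by move=> h; rewrite /act_mx big1 // => j _; rewrite h scaler0. Qed.

Lemma act_Q t i : act_mx Q t i = \sum_c act_mx (E c) (act_mx (E c) t) i.
Proof. by rewrite act_sum_mx; apply: eq_bigr => c _; rewrite act_mxM. Qed.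

(** Transposing [Q = H Q Q] gives [Q = Q Q H^T], so [Q] annihilates [t - Q H^T t], and with it every
    [E c] does. What is subtracted has the form [Q u], a sum of images of the [E c]. *)
Lemma kernel_decomposition t : exists z y,
  (forall c i, act_mx (E c) z i = 0) /\
  (forall i, t i - z i = \sum_c act_mx (E c) (y c) i).
Proof.
have [H hH] := Q_factor.
have hH' : Q = Q *m Q *m H^T by rewrite -{1}Q_sym {1}hH !trmx_mul Q_sym.
pose u := act_mx H^T t.
exists (fun i => t i - act_mx Q u i), (fun c => act_mx (E c) u); split=> [c i|i].
  have [B ->] := E_factor c; rewrite act_mxM; apply: act_mx0 => j.
  by rewrite act_mx_sub /u -!act_mxM -hH' subrr.
by rewrite subKr act_Q.
Qed.

(* The complement of the common kernel is the sum of the images, on which Q is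
   invertible: t - z = H Q (t - z) = H Q t. *)
Lemma kernel_decomposition_diff t z y :
  (forall c i, act_mx (E c) z i = 0) ->
  (forall i, t i - z i = \sum_c act_mx (E c) (y c) i) ->
  forall i, lspan (fun v => exists c j, v = act_mx (E c) t j) (t i - z i).
Proof.
move=> hz hy i.
have [H hH] := Q_factor.
have /fin_all_exists [B hB] c := E_factor c.
pose x := fun i => t i - z i.
(* [E c] and [Q] are symmetric, so [E c = B Q] also reads [E c = Q B^T], which puts the difference
   in the image of [Q]. *)
have [w hw] : exists w, forall i, x i = act_mx Q w i.
  exists (fun i => \sum_c act_mx (B c)^T (y c) i) => j.
  rewrite /x hy act_mx_sum; apply: eq_bigr => c _.
  by rewrite -act_mxM -{1}Q_sym -trmx_mul -hB E_sym.
have Qx j : act_mx Q x j = \sum_c act_mx (E c) (act_mx (E c) t) j.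
  by rewrite act_mx_sub [act_mx Q z j]act_Q big1 ?subr0 ?act_Q // => c _; apply: act_mx0.
have -> : t i - z i = act_mx H (act_mx Q x) i.
  by rewrite -[LHS]/(x i) hw {1}hH act_mxM (eq_act _ (act_mxM _ _ _)) -(eq_act _ (eq_act _ hw)).
apply: lspan_sum => j _; apply: lspanZ; rewrite Qx; apply: lspan_sum => c _.
by apply: lspan_sum => j' _; apply/lspanZ/lspan_gen; exists c, j'.
Qed.

End Orthogonal.

(** * Traces as symmetric real matrices acting on components *)

Section TracelessPart.
Variable F : numClosedFieldType.
Local Notation jetalg := (jetalg F).

Lemma filter_zip_eq (x0 : 'I_4) (P : pred nat) (l : seq nat) (s s' : seq 'I_4) :
  size s = size l -> size s' = size l ->
  [seq x.2 | x <- zip l s & P x.1] = [seq x.2 | x <- zip l s' & P x.1] <->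
  (forall p, (p < size l)%N -> P (nth 0%N l p) -> nth x0 s p = nth x0 s' p).
Proof.
elim: l s s' => [|a l IH] [|b s] [|b' s'] //= [hs] [hs'].
have [Pa|nPa] := boolP (P a) => /=; split.
- by move=> [-> /(IH _ _ hs hs') h] [|p] //=; apply: h.
- move=> h; congr (_ :: _); first exact: (h 0%N).
  by apply/IH => // p; apply: (h p.+1).
- by move=> /(IH _ _ hs hs') h [|p] //=; [rewrite (negbTE nPa) | apply: h].
- by move=> h; apply/IH => // p; apply: (h p.+1).
Qed.

Lemma rem2_eq k (s s' : seq 'I_4) i j : size s = k -> size s' = k ->
  rem2 s i j = rem2 s' i j <->
  (forall p, (p < k)%N -> p != i -> p != j -> nth ord0 s p = nth ord0 s' p).
Proof.
move=> hs hs'; rewrite /rem2 hs hs'.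
rewrite (@filter_zip_eq ord0 (fun p => (p != i) && (p != j))) ?size_iota //.
split=> h p pk; first by move=> pi pj; apply: h; rewrite // nth_iota // pi pj.
by rewrite nth_iota // add0n => /andP [pi pj]; apply: h.
Qed.

Definition set2 (s : seq 'I_4) i j a := set_nth ord0 (set_nth ord0 s i a) j a.

Lemma size_set2 k s i j a : size s = k -> (i < k)%N -> (j < k)%N -> size (set2 s i j a) = k.
Proof.
move=> <- hi hj; rewrite !size_set_nth.
by rewrite (maxn_idPr hi) (maxn_idPr hj).
Qed.
Lemma nth_set2 s i j a p :
  nth ord0 (set2 s i j a) p = if (p == i) || (p == j) then a else nth ord0 s p.
Proof. by rewrite /set2 nth_set_nth /= nth_set_nth /=; case: (p == j); rewrite ?orbT ?orbF. Qed.
Lemma rem2_set2 k s i j a : size s = k -> (i < k)%N -> (j < k)%N ->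
  rem2 (set2 s i j a) i j = rem2 s i j.
Proof.
move=> hs hi hj; apply/(rem2_eq i j (size_set2 a hs hi hj) hs) => p _ pi pj.
by rewrite nth_set2 (negbTE pi) (negbTE pj).
Qed.

Lemma set2P k s s' i j a : size s = k -> size s' = k -> (i < k)%N -> (j < k)%N ->
  rem2 s' i j = rem2 s i j -> nth ord0 s' i = a -> nth ord0 s' j = a -> s' = set2 s i j a.
Proof.
move=> hs hs' hi hj /(rem2_eq i j hs' hs) h hia hja.
apply: (@eq_from_nth _ ord0); first by rewrite (size_set2 _ hs).
move=> p; rewrite hs' => pk; rewrite nth_set2.
have [->//|pi] := eqVneq p i; have [->//|pj] := eqVneq p j.
exact: h.
Qed.

(** The [rem2] factor is a Kronecker delta on the untouched indices and the metric is diagonal, so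
    of all index tuples only the [set2 s i j a] contribute. *)
Lemma sum_set2 (V : lmodType F) k (f : seq 'I_4 -> V) s i j :
  size s = k -> (i < j)%N -> (j < k)%N ->
  \sum_(s' : k.-tuple 'I_4)
     (eta F (nth ord0 s' i) (nth ord0 s' j) * (rem2 s' i j == rem2 s i j)%:R) *: f s' =
  \sum_a eta F a a *: f (set2 s i j a).
Proof.
move=> hs ij jk; have ik := ltn_trans ij jk.
rewrite (partition_big (fun s' : k.-tuple 'I_4 => nth ord0 s' i) predT) //=.
apply: eq_bigr => a _.
have hz : size (set2 s i j a) == k by rewrite (size_set2 _ hs).
rewrite (bigD1 (Tuple hz)) /=; last by rewrite nth_set2 eqxx.
rewrite big1 ?addr0 => [|s' /andP [/eqP s'i ns']].
  by rewrite !nth_set2 !eqxx orbT (rem2_set2 _ hs) // eqxx mulr1.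
have [e|] := eqVneq (rem2 s' i j) (rem2 s i j); last by rewrite mulr0 scale0r.
have [e'|nj] := eqVneq (nth ord0 s' i) (nth ord0 s' j); last first.
  by rewrite /eta (negbTE nj) mul0r scale0r.
case/eqP: ns'; apply/val_inj => /=.
by apply: (set2P hs (size_tuple s') ik jk e s'i); rewrite -e'.
Qed.

Lemma eta_sq a : eta F a a * eta F a a = 1.
Proof. by rewrite /eta eqxx; case: ifP; rewrite ?mulrNN mulr1. Qed.

Lemma eta_real a b : (eta F a b)^* = eta F a b.
Proof. by rewrite /eta; case: ifP => _; [case: ifP|]; rewrite ?rmorphN ?rmorph1 ?rmorph0. Qed.

Section FixedRank.
Variable k : nat.
Let n := #|{: k.-tuple 'I_4}|.
Let tup (a : 'I_n) : k.-tuple 'I_4 := enum_val a.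

(** Contraction of the pair [c] followed by insertion of the metric at the same place. In components
    insertion is the transpose of contraction, so the matrix is symmetric although the metric is
    indefinite. Pairs that are not increasing give 0. *)
Definition trace_mx (c : 'I_k * 'I_k) : 'M[F]_n :=
  \matrix_(a, b) if (c.1 < c.2)%N then
    eta F (nth ord0 (tup a) c.1) (nth ord0 (tup a) c.2) *
    eta F (nth ord0 (tup b) c.1) (nth ord0 (tup b) c.2) *
    (rem2 (tup b) c.1 c.2 == rem2 (tup a) c.1 c.2)%:R else 0.

Lemma trace_mx_sym c : (trace_mx c)^T = trace_mx c.
Proof. by apply/matrixP => a b; rewrite !mxE; case: ifP => // _; rewrite eq_sym [eta F _ _ * _]mulrC. Qed.
Lemma trace_mx_real c : map_mx Num.conj (trace_mx c) = trace_mx c.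
Proof.
apply/matrixP => a b; rewrite !mxE; case: ifP => _; last by rewrite rmorph0.
by rewrite !rmorphM /= !eta_real conjC_nat.
Qed.

Definition ctens (T : tensor F) (a : 'I_n) : jetalg := cls (T (tup a)).

Lemma act_trace_mx (V : lmodType F) (f : seq 'I_4 -> V) (c : 'I_k * 'I_k) (a : 'I_n) : (c.1 < c.2)%N ->
  act_mx (trace_mx c) (fun b => f (tup b)) a =
  eta F (nth ord0 (tup a) c.1) (nth ord0 (tup a) c.2) *:
    \sum_x eta F x x *: f (set2 (tup a) c.1 c.2 x).
Proof.
move=> h; rewrite -(sum_set2 f (size_tuple (tup a)) h (ltn_ord _)) scaler_sumr.
rewrite (reindex tup) /=; last by exists enum_rank => x _; rewrite /tup ?enum_valK ?enum_rankK.
by apply: eq_bigr => b _; rewrite mxE h scalerA mulrA.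
Qed.

Lemma act_trace_mx0 (V : lmodType F) (f : 'I_n -> V) (c : 'I_k * 'I_k) a : ~~ (c.1 < c.2)%N ->
  act_mx (trace_mx c) f a = 0.
Proof. by move=> h; rewrite /act_mx big1 // => b _; rewrite mxE (negbTE h) scale0r. Qed.

Lemma cls_trace_at T i j s : cls (trace_at T i j s) = \sum_x eta F x x *: cls (T (set2 s i j x)).
Proof. by rewrite /trace_at cls_esum4; apply: eq_bigr => x _; rewrite clsZ. Qed.

Lemma is_tracelessP T : is_traceless k T <->
  (forall c a, act_mx (trace_mx c) (ctens T) a = 0).
Proof.
split=> [h c a|h s hs i j ij jk].
  have [lt|/act_trace_mx0 //] := boolP (c.1 < c.2)%N.
  rewrite (act_trace_mx (fun s => cls (T s))) // -cls_trace_at.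
  have /clsP -> := h (tup a) (size_tuple _) _ _ lt (ltn_ord _).
  by rewrite scaler0.
have ik := ltn_trans ij jk; apply/clsP; rewrite cls_trace_at.
(* Inserting the metric loses no information: at a tuple with both entries [ord0] its coefficient is
   1. *)
have hz : size (set2 s i j ord0) == k by rewrite (size_set2 _ hs).
have := h (Ordinal ik, Ordinal jk) (enum_rank (Tuple hz)).
rewrite (act_trace_mx (fun s => cls (T s))) //= /tup enum_rankK /= !nth_set2 !eqxx orbT.
rewrite [eta _ _ _](_ : _ = 1) // scale1r => e; rewrite -[RHS]e.
apply: eq_bigr => x _; congr (_ *: cls (T _)).
apply: (@eq_from_nth _ ord0) => [|p _]; last by rewrite !nth_set2; case: ifP.
by rewrite !(@size_set2 k) // (eqP hz).
Qed.

Lemma sum_pairs (V : nmodType) (f : nat * nat -> V) :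
  \sum_(ij <- pairs k) f ij = \sum_(c : 'I_k * 'I_k | (c.1 < c.2)%N) f (val c.1, val c.2).
Proof.
rewrite big_filter big_mkcond big_allpairs /=.
rewrite [RHS]big_mkcond -(pair_bigA _ (fun i j : 'I_k => if (i < j)%N then f (val i, val j) else 0)) /=.
have E (g : nat -> V) : \sum_(i <- iota 0 k) g i = \sum_(i < k) g i.
  by rewrite -[X in iota 0 X]subn0 -/(index_iota 0 k) big_mkord.
by rewrite E; apply: eq_bigr => i _; rewrite E.
Qed.

Lemma in_eta_idealP T : in_eta_ideal k T <->
  exists y, forall a, ctens T a = \sum_c act_mx (trace_mx c) (y c) a.
Proof.
split=> [[Y hY]|[y hy]].
  (* The metric contracted with itself gives 4, which [4^-1] undoes. *)
  exists (fun (c : 'I_k * 'I_k) (b : 'I_n) => 4^-1 *: (eta F (nth ord0 (tup b) c.1) (nth ord0 (tup b) c.2) *: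
                       cls (Y c.1 c.2 (rem2 (tup b) c.1 c.2)))) => a.
  have /clsP := hY (tup a) (size_tuple _); rewrite /ctens => ->.
  rewrite cls_esum big_map sum_pairs /= big_mkcond /=; apply: eq_bigr => c _.
  case: ifP => [lt|/negbT /act_trace_mx0 -> //]; rewrite clsZ.
  rewrite (act_trace_mx (fun s => 4^-1 *: (eta F (nth ord0 s c.1) (nth ord0 s c.2) *:
                       cls (Y c.1 c.2 (rem2 s c.1 c.2))))) //; congr (_ *: _).
  under eq_bigr => x _.
    rewrite !nth_set2 !eqxx orbT (@rem2_set2 k) ?size_tuple //.
    rewrite scalerA [eta F x x * _]mulrC -scalerA [eta F x x *: _]scalerA eta_sq scale1r.
    over.
  by rewrite sumr_const card_ord -scaler_nat scalerA divff ?scale1r // pnatr_eq0.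
(* [g c] contracts [y c] with the metric in the pair [c], leaving a tensor in the remaining indices
   [t]. *)
pose g (c : 'I_k * 'I_k) t : jetalg := \sum_(s' : k.-tuple 'I_4)
   (eta F (nth ord0 s' c.1) (nth ord0 s' c.2) * (rem2 s' c.1 c.2 == t)%:R) *: y c (enum_rank s').
exists (fun i j t => if insub i is Some i' then if insub j is Some j' then rep (g (i', j') t)
  else Const 0 else Const 0) => s hs.
apply/clsP; rewrite cls_esum big_map sum_pairs.
have hs' : size s == k by apply/eqP.
have := hy (enum_rank (Tuple hs')); rewrite /ctens /tup enum_rankK /= => ->.
rewrite [RHS]big_mkcond; apply: eq_bigr => c _.
case: ifP => [lt|/negbT /act_trace_mx0 -> //]; rewrite clsZ !valK repK scaler_sumr.
rewrite /act_mx (reindex (@enum_rank {: k.-tuple 'I_4})) /=; last first.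
  by exists enum_val => x _; rewrite ?enum_valK ?enum_rankK.
by apply: eq_bigr => s' _; rewrite mxE lt /tup !enum_rankK scalerA mulrA; case: c lt.
Qed.

(** [epsilon] has the two properties only if some tensor does; the orthogonal decomposition supplies
    one. *)
Lemma traceless_part_spec (T : tensor F) : is_traceless k (traceless_part k T) /\
  in_eta_ideal (F := F) k (fun s => sub (T s) (traceless_part k T s)).
Proof.
apply: (epsilon_spec (inhabits _) (fun Z => is_traceless k Z /\ in_eta_ideal (F := F) k (fun s => sub (T s) (Z s)))).
have [z [y [hz hy]]] := kernel_decomposition trace_mx_sym trace_mx_real (ctens T).
pose Z (s : seq 'I_4) : expr F := if insub s is Some s' then rep (z (enum_rank (s' : k.-tuple 'I_4))) else Const 0.
have hZ a : ctens Z a = z a by rewrite /ctens /Z valK enum_valK repK.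
exists Z; split; first by apply/is_tracelessP => c a; rewrite (eq_act _ hZ).
by apply/in_eta_idealP; exists y => a; rewrite -hy -hZ -cls_sub.
Qed.

Lemma traceless_part_diff (T : tensor F) s : size s = k ->
  lspan (fun v => exists i j s', [/\ (i < j)%N, (j < k)%N, size s' = k & v = cls (trace_at T i j s')])
    (cls (T s) - cls (traceless_part k T s)).
Proof.
move=> hs; have hs' : size s == k by apply/eqP.
have [/is_tracelessP hz /in_eta_idealP [y hy]] := traceless_part_spec T.
have hd a : ctens T a - ctens (traceless_part k T) a =
    \sum_c act_mx (trace_mx c) (y c) a by rewrite -hy /ctens cls_sub.
have := kernel_decomposition_diff trace_mx_sym trace_mx_real hz hd (enum_rank (Tuple hs')).
rewrite /ctens /tup enum_rankK /=; apply: (lspan_linear (f := idfun)) => v [c [a ->]] /=.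
have [lt|/act_trace_mx0 ->] := boolP (c.1 < c.2)%N; last exact: lspan0.
rewrite (act_trace_mx (fun s => cls (T s))) // -cls_trace_at; apply/lspanZ/lspan_gen.
by exists c.1, c.2, (tup a); rewrite size_tuple ltn_ord.
Qed.
End FixedRank.
End TracelessPart.

(** * Polynomial coefficients *)

Section Polynomials.
Variable F : numClosedFieldType.
Local Notation S := {mpoly F[4]}.
Implicit Types (f g h : S) (m : 'X_{1..4}).

Lemma mpoly_mulX_ind (Q : S -> Prop) :
  (forall c f g, Q f -> Q g -> Q (c *: f + g)) -> Q 0 -> Q 1 ->
  (forall i f, Q f -> Q ('X_i * f)) -> forall f, Q f.
Proof.
move=> Ql Q0 Q1 QX; elim/mpolyind => // c m p _ _ Qp; apply: (Ql) => {p Qp c} //.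
move: {2}(mdeg m) (erefl (mdeg m)) => d; elim: d m => [|d IH] m hm.
  by move/eqP: hm; rewrite mdeg_eq0 => /eqP ->; rewrite mpolyX0.
have [i hi] : exists i, m i != 0%N.
  apply/existsP; rewrite -[[exists _, _]]negbK negb_exists; apply/negP => /forallP h.
  have : m = 0%MM by apply/mnmP => i; rewrite mnm0E; have /negPn/eqP := h i.
  by move=> e; move: hm; rewrite e mdeg0.
have e : m = (U_(i) + (m - U_(i)))%MM.
  apply/mnmP => j; rewrite mnmDE mnmBE mnm1E; have [<-|] := eqVneq i j; last by rewrite add0n subn0.
  by rewrite addnC subnK // lt0n.
rewrite e mpolyXD; apply: QX; apply: IH.
by move: hm; rewrite {1}e mdegD mdeg1 => -[].
Qed.

Definition x2 : S := \sum_k eta F k k *: ('X_k * 'X_k).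

Definition cong f g := exists h, f - g = x2 * h.

Lemma cong_refl f : cong f f. Proof. by exists 0; rewrite subrr mulr0. Qed.
Lemma cong_sym f g : cong f g -> cong g f.
Proof. by move=> [h e]; exists (- h); rewrite mulrN -e opprB. Qed.
Lemma cong_trans g f h : cong f g -> cong g h -> cong f h.
Proof. by move=> [a ha] [b hb]; exists (a + b); rewrite mulrDr -ha -hb addrA subrK. Qed.
Lemma congD f g f' g' : cong f g -> cong f' g' -> cong (f + f') (g + g').
Proof. by move=> [a ha] [b hb]; exists (a + b); rewrite mulrDr -ha -hb opprD addrACA. Qed.
Lemma congMl a f g : cong f g -> cong (a * f) (a * g).
Proof. by move=> [h e]; exists (a * h); rewrite -mulrBr e mulrCA. Qed.
Lemma congZ c f g : cong f g -> cong (c *: f) (c *: g).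
Proof. by move=> [h e]; exists (c *: h); rewrite -scalerBr e scalerAr. Qed.
Lemma cong_sum (I : finType) (f g : I -> S) :
  (forall i, cong (f i) (g i)) -> cong (\sum_i f i) (\sum_i g i).
Proof. by move=> h; apply: (big_ind2 cong); [apply: cong_refl | move=> *; apply: congD|]. Qed.

(** In [X_0 f = x2 g] put [X_0 = 0]: the quadric stays nonzero, so [g] restricts to zero and is
    divisible by [X_0], which then cancels. *)
Lemma cong_cancel_X0 f : cong ('X_ord0 * f) 0 -> cong f 0.
Proof.
pose lq : 4.-tuple S := [tuple if i == ord0 then 0 else 'X_i | i < 4].
have evX i : 'X_i \mPo lq = if i == ord0 then 0 else 'X_i by rewrite comp_mpolyXU nth_mktuple.
have split g : exists g', g = (g \mPo lq) + 'X_ord0 * g'.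
  elim/mpoly_mulX_ind: g => [c f1 f2 [g1 e1] [g2 e2]|||i f1 [g1 e1]].
  - exists (c *: g1 + g2); rewrite {1}e1 {1}e2 comp_mpolyD comp_mpolyZ.
    by rewrite scalerDr mulrDr scalerAr addrACA.
  - by exists 0; rewrite comp_mpoly0 mulr0 addr0.
  - by exists 0; rewrite comp_mpoly1 mulr0 addr0.
  - rewrite rmorphM /= evX; have [->|ni] := eqVneq i ord0; first by exists f1; rewrite mul0r add0r.
    by exists ('X_i * g1); rewrite {1}e1 mulrDr mulrCA.
move=> [g]; rewrite subr0 => e.
have [g' eg] := split g.
have g0 : g \mPo lq = 0.
  have := congr1 (comp_mpoly lq) e; rewrite !rmorphM /= evX eqxx mul0r => /esym/eqP.
  rewrite mulf_eq0 => /orP [/eqP h|/eqP //].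
  have E : x2 \mPo lq = \sum_k eta F k k *: (('X_k \mPo lq) * ('X_k \mPo lq)).
    rewrite /x2 (raddf_sum (comp_mpoly lq)); apply: eq_bigr => k _.
    by rewrite /= comp_mpolyZ rmorphM.
  (* A point at which the restricted quadric takes the value -1. *)
  pose v (i : 'I_4) : F := if i == 1 then 1 else 0.
  have := congr1 (meval v) h; rewrite E (raddf_sum (meval v)) meval0 /= (bigD1 1) //=.
  rewrite big1 => [|i ni]; rewrite mevalZ mevalM evX.
    rewrite addr0 /= mevalXU /v /= !mulr1 /eta /=.
    by move/eqP; rewrite oppr_eq0 oner_eq0.
  case: eqP => _; rewrite ?meval0 ?mulr0 //.
  by rewrite mevalXU /v (negbTE ni) !mulr0.
exists g'; rewrite subr0; apply: (@mulfI _ 'X_ord0); first by rewrite -msupp_eq0 msuppX.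
by rewrite e eg g0 add0r mulrCA.
Qed.

Lemma euler d f : f \is d.-homog -> \sum_i 'X_i * f^`M(i) = d%:R *: f.
Proof.
move=> /dhomogP hf; rewrite {2}[f]mpolyE.
have -> : \sum_i 'X_i * f^`M(i) = \sum_(m <- msupp f) f@_m *: \sum_i 'X_i * ('X_[m] : S)^`M(i).
  under [RHS]eq_bigr do rewrite scaler_sumr.
  rewrite exchange_big; apply: eq_bigr => i _; rewrite {1}[f]mpolyE raddf_sum mulr_sumr.
  by apply: eq_bigr => m _; rewrite /= mderivZ scalerAr.
rewrite scaler_sumr big_seq [RHS]big_seq; apply: eq_bigr => m /hf hm.
rewrite scalerA mulrC -scalerA; congr (_ *: _).
rewrite -hm /= mdegE natr_sum scaler_suml; apply: eq_bigr => i _.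
rewrite mderivX -scalerAr -mpolyXD; have [->|hi] := eqVneq (m i) 0%N; first by rewrite !scale0r.
congr (_ *: 'X_[_]); apply/mnmP => j; rewrite mnmDE mnmBE mnm1E.
by have [<-|] := eqVneq i j; rewrite ?add0n ?subn0 // addnC subnK // lt0n.
Qed.

Lemma mderiv_homog0 i f : f \is 0.-homog -> f^`M(i) = 0.
Proof.
move=> /dhomogP hf; rewrite [f]mpolyE raddf_sum big_seq big1 // => m /hf /= /eqP.
by rewrite mdeg_eq0 => /eqP ->; rewrite /= mderivZ mderivX mnm0E scale0r scaler0.
Qed.

Lemma pihomog_mulX d i f : pihomog mdeg d.+1 ('X_i * f) = 'X_i * pihomog mdeg d f.
Proof.
elim/mpolyind: f => [|c m p _ _ IH]; first by rewrite mulr0 !raddf0 mulr0.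
rewrite mulrDr !raddfD /= mulrDr IH -scalerAr !linearZ /= -scalerAr -mpolyXD !pihomogX.
by rewrite /= mdegD mdeg1 add1n eqSS; case: eqP; rewrite ?mpolyXD ?mulr0.
Qed.

End Polynomials.

(** * Polynomials as differential operators, and symbols of linear elements *)

Section Action.
Variable F : numClosedFieldType.
Local Notation S := {mpoly F[4]}.
Local Notation P := (jetalg F).
Implicit Types (f g h : S) (m : 'X_{1..4}) (x y : P).
Local Notation QP := (@QP F).
Local Notation dP := (@dP F).
Local Notation jet := (jet F).

Definition dseq (s : seq 'I_4) x : P := foldr (fun i y => dP i y) x s.

Lemma dseq_cons i s x : dseq (i :: s) x = dP i (dseq s x). Proof. by []. Qed.
Lemma dseq_cat s t x : dseq (s ++ t) x = dseq s (dseq t x).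
Proof. exact: foldr_cat. Qed.
Lemma dseq_dP i s x : dseq s (dP i x) = dP i (dseq s x).
Proof. by elim: s => //= j s ->; rewrite dPC. Qed.
Lemma dseq_perm s t x : perm_eq s t -> dseq s x = dseq t x.
Proof.
elim: s t => [|i s IH] t; first by rewrite perm_sym => /perm_nilP ->.
move=> h; have it : i \in t by rewrite -(perm_mem h) mem_head.
case/splitPr: it h => t1 t2 h.
rewrite dseq_cat !dseq_cons dseq_dP -dseq_cat; congr (dP _ _); apply: IH.
by rewrite -(perm_cons i) (perm_trans h) // perm_sym -cat1s perm_catCA.
Qed.
Fact dseq_linear s : linear (dseq s).
Proof. by move=> c x y; elim: s => //= i s ->; rewrite linearP. Qed.
HB.instance Definition _ s := GRing.isLinear.Build F _ _ _ (dseq s) (dseq_linear s).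

Definition mnm_seq m : seq 'I_4 := flatten [seq nseq (m i) i | i <- enum 'I_4].
Lemma count_mnm_seq m i : count_mem i (mnm_seq m) = m i.
Proof.
rewrite count_flatten -map_comp sumnE big_map big_enum /= (bigD1 i) //=.
rewrite count_nseq /= eqxx mul1n big1 ?addn0 // => j ji.
by rewrite count_nseq /= (negbTE ji) mul0n.
Qed.
Lemma mnm_seqU i m : perm_eq (mnm_seq (U_(i) + m)) (i :: mnm_seq m).
Proof.
by apply/allP => j _; rewrite /= !count_mnm_seq mnmDE mnm1E.
Qed.

Definition act f x : P := \sum_(m <- msupp f) f@_m *: dseq (mnm_seq m) x.

Lemma actwE f x k : (msize f <= k)%N ->
  act f x = \sum_(m : 'X_{1..4 < k}) f@_m *: dseq (mnm_seq m) x.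
Proof.
pose I : subFinType _ := 'X_{1..4 < k}.
move=> le_pk; rewrite /act (big_mksub I) /=; first last.
  by move=> m /msize_mdeg_lt/leq_trans/(_ le_pk).
  by rewrite msupp_uniq.
by rewrite big_rmcond //= => j /memN_msupp_eq0 ->; rewrite scale0r.
Qed.

Lemma actP c f g x : act (c *: f + g) x = c *: act f x + act g x.
Proof.
pose k := maxn (msize (c *: f + g)) (maxn (msize f) (msize g)).
have h1 : (msize (c *: f + g) <= k)%N by apply: leq_maxl.
have h2 : (msize f <= k)%N by rewrite (leq_trans _ (leq_maxr _ _)) // leq_maxl.
have h3 : (msize g <= k)%N by rewrite (leq_trans _ (leq_maxr _ _)) // leq_maxr.
rewrite (actwE _ h1) (actwE _ h2) (actwE _ h3) scaler_sumr -big_split; apply: eq_bigr => m _.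
by rewrite mcoeffD mcoeffZ scalerDl scalerA.
Qed.
Lemma act0 x : act 0 x = 0. Proof. by rewrite /act msupp0 big_nil. Qed.
Lemma actZ c f x : act (c *: f) x = c *: act f x.
Proof. by rewrite -[c *: f]addr0 actP act0 addr0. Qed.
Lemma actD f g x : act (f + g) x = act f x + act g x.
Proof. by rewrite -[f]scale1r actP !scale1r. Qed.
Lemma actN f x : act (- f) x = - act f x.
Proof. by rewrite -scaleN1r actZ scaleN1r. Qed.
Lemma act_suml (I : Type) (r : seq I) (p : pred I) (f : I -> S) x :
  act (\sum_(i <- r | p i) f i) x = \sum_(i <- r | p i) act (f i) x.
Proof. exact: (big_morph (fun f => act f x) (fun f g => actD f g x) (act0 x)). Qed.
Fact act_linear f : linear (act f).
Proof.
move=> c x y; rewrite /act scaler_sumr -big_split; apply: eq_bigr => m _.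
by rewrite linearP scalerDr !scalerA mulrC.
Qed.
HB.instance Definition _ f := GRing.isLinear.Build F _ _ _ (act f) (act_linear f).
Lemma act_Xm m x : act 'X_[m] x = dseq (mnm_seq m) x.
Proof. by rewrite /act msuppX big_seq1 mcoeffX eqxx scale1r. Qed.
Lemma act1 x : act 1 x = x.
Proof.
rewrite -mpolyX0 act_Xm; have -> : mnm_seq 0 = [::] by rewrite /mnm_seq; elim: (enum _) => //= i s ->; rewrite mnm0E.
by [].
Qed.
Lemma actX i f x : act ('X_i * f) x = dP i (act f x).
Proof.
elim/mpolyind: f => [|c m p _ _ IH]; first by rewrite mulr0 act0 linear0.
rewrite mulrDr !actD linearD IH /= -scalerAr !actZ linearZ -mpolyXD !act_Xm /=.
by rewrite (dseq_perm _ (mnm_seqU i m)).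
Qed.
Lemma actX1 i x : act 'X_i x = dP i x. Proof. by rewrite -[X in act X]mulr1 actX act1. Qed.
Lemma actM f g x : act (f * g) x = act f (act g x).
Proof.
elim/mpoly_mulX_ind: f => [c f1 f2 e1 e2|||i f1 e1].
- by rewrite mulrDl -scalerAl !actP e1 e2.
- by rewrite mul0r !act0.
- by rewrite mul1r act1.
- by rewrite -mulrA !actX e1.
Qed.
Lemma act_dP f i x : act f (dP i x) = act ('X_i * f) x.
Proof. by rewrite mulrC actM actX1. Qed.
Lemma QP_act f x : QP (act f x) = act f (QP x).
Proof.
elim/mpoly_mulX_ind: f => [c f1 f2 e1 e2|||i f1 e1].
- by rewrite !actP QPD QPZ e1 e2.
- by rewrite !act0 linear0.
- by rewrite !act1.
- by rewrite !actX QP_dP e1.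
Qed.

Lemma jet_dseq (y : fld) s : jet (y, s) = dseq s (jet (y, [::])).
Proof. by elim: s => //= i s <-; rewrite dP_jet. Qed.

Lemma dseq_act s x : exists f, dseq s x = act f x.
Proof.
elim: s => [|i s [f e]]; first by exists 1; rewrite act1.
by exists ('X_i * f); rewrite actX -e.
Qed.

Lemma act_x2 (y : fld) : act (x2 F) (jet (y, [::])) = 0.
Proof.
rewrite /x2 act_suml -[RHS](dP_wave F y [::]); apply: eq_bigr => k _.
by rewrite actZ actX actX1.
Qed.

Lemma act_cong0 f (y : fld) : cong f 0 -> act f (jet (y, [::])) = 0.
Proof. by move=> [h]; rewrite subr0 => ->; rewrite mulrC actM act_x2 linear0. Qed.

Section LinearCoefficient.
Variable phi : fld -> F.
Hypothesis phi_sym : forall (m n : 'I_4), phi (fH m n) = phi (fH n m).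

(* Coefficient of the linear part of an expression along [phi], where derivative
   indices are turned into polynomial variables. *)
Fixpoint lin (e : expr F) : S :=
  match e with
  | Var g => phi g.1 *: \prod_(i <- g.2) 'X_i
  | Const _ => 0
  | Add a b => lin a + lin b
  | Mul a b => aug a *: lin b + aug b *: lin a
  end.

(** Only the wave equation forces a congruence instead of an equality: its image is a multiple of
    [x2]. This limits the relations between jets, because a linear identity in [P] becomes a
    congruence of polynomials. *)
Lemma lin_peq a b : peq a b -> cong (lin a) (lin b).
Proof.
elim=> //=.
- by move=> *; apply: cong_refl.
- by move=> *; apply: cong_sym.
- by move=> {}a {}b c _ h1 _; apply: cong_trans.
- by move=> *; apply: congD.
- move=> {}a a' {}b b' /aug_peq -> h1 /aug_peq -> h2.
  by apply: congD; apply: congZ.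
- by move=> *; rewrite addrA; apply: cong_refl.
- by move=> *; rewrite addrC; apply: cong_refl.
- by move=> *; rewrite add0r; apply: cong_refl.
- by move=> *; rewrite scaler0 addr0 scaleN1r subrr; apply: cong_refl.
- move=> {}a {}b c; rewrite !scalerDr !scalerA addrA [aug c * _]mulrC [aug c * _]mulrC.
  exact: cong_refl.
- by move=> *; rewrite scale1r scaler0 addr0; apply: cong_refl.
- by move=> *; rewrite scale1r scaler0 add0r; apply: cong_refl.
- by move=> {}a {}b c; rewrite scalerDl scalerDr addrACA; apply: cong_refl.
- by move=> {}a {}b c; rewrite scalerDl scalerDr addrACA; apply: cong_refl.
- by move=> *; rewrite addr0; apply: cong_refl.
- by move=> *; rewrite !scaler0 addr0; apply: cong_refl.
- by move=> *; rewrite scaler0 addrC; apply: cong_refl.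
- by move=> *; rewrite !scale0r !(scaler0, addr0); apply: cong_refl.
- by move=> y s s' h; rewrite (perm_big _ h); apply: cong_refl.
- by move=> m n s; rewrite phi_sym; apply: cong_refl.
- move=> y s; exists (phi y *: \prod_(i <- s) 'X_i); rewrite subr0 /esum4 /x2.
  rewrite -[\sum_k _]big_enum; elim: (enum _) => [|k l IH]; first by rewrite big_nil mul0r.
  rewrite big_cons mulrDl -IH /= scaler0 addr0; congr (_ + _).
  by rewrite !big_cons -scalerAl -!scalerAr !mulrA.
Qed.

Definition linP x : S := lin (rep x).
Lemma linP_cls e : cong (linP (cls e)) (lin e).
Proof. exact/lin_peq/rep_cls. Qed.
Lemma linP0 : cong (linP 0) 0. Proof. exact: linP_cls (Const 0). Qed.
Lemma linPD x y : cong (linP (x + y)) (linP x + linP y).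
Proof.
elim/cls_ind: x => a; elim/cls_ind: y => b; rewrite -clsD.
apply: cong_trans (linP_cls _) _; apply: cong_sym; exact: congD (linP_cls a) (linP_cls b).
Qed.
Lemma linPZ c x : cong (linP (c *: x)) (c *: linP x).
Proof.
elim/cls_ind: x => a; rewrite -clsZ; apply: cong_trans (linP_cls _) _ => /=.
by rewrite scaler0 addr0; apply/congZ/cong_sym/linP_cls.
Qed.
Lemma linP_sum (I : finType) (f : I -> P) : cong (linP (\sum_i f i)) (\sum_i linP (f i)).
Proof.
elim/big_rec2: _ => [|i y x _ IH]; first exact: linP0.
by apply: cong_trans (linPD _ _) _; apply: congD; first exact: cong_refl.
Qed.
Lemma aug_dd i (e : expr F) : aug (dd i e) = 0.
Proof. by elim: e => //= a -> b ->; rewrite ?addr0 // mul0r mulr0 addr0. Qed.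
Lemma lin_dd i e : lin (dd i e) = 'X_i * lin e.
Proof.
elim: e => [[f s]|c|a ha b hb|a ha b hb] /=; rewrite ?mulr0 //.
- by rewrite big_cons scalerAr.
- by rewrite ha hb mulrDr.
- by rewrite !aug_dd !scale0r add0r addr0 ha hb mulrDr -!scalerAr addrC.
Qed.
Lemma linP_dP i x : cong (linP (dP i x)) ('X_i * linP x).
Proof.
elim/cls_ind: x => a; rewrite -cls_dd; apply: cong_trans (linP_cls _) _.
by rewrite lin_dd; apply/congMl/cong_sym/linP_cls.
Qed.
Lemma linP_jet (f : fld) : cong (linP (jet (f, [::]))) (phi f *: 1).
Proof. by apply: cong_trans (linP_cls _) _; rewrite /= big_nil; apply: cong_refl. Qed.
Lemma linP_act f x : cong (linP (act f x)) (f * linP x).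
Proof.
elim/mpoly_mulX_ind: f => [c f1 f2 h1 h2|||i f1 h1].
- rewrite actP mulrDl -scalerAl; apply: cong_trans (linPD _ _) _; apply: congD => //.
  by apply: cong_trans (linPZ _ _) _; apply: congZ.
- by rewrite act0 mul0r; apply: linP0.
- by rewrite act1 mul1r; apply: cong_refl.
- by rewrite actX -mulrA; apply: cong_trans (linP_dP _ _) _; apply: congMl.
Qed.
End LinearCoefficient.

End Action.

(** * Euler identities for divergence-free symmetric matrices of polynomials *)

Section Divergence.
Variable F : numClosedFieldType.
Local Notation S := {mpoly F[4]}.
Variables (K : 'I_4 -> 'I_4 -> S) (N : nat).
Hypotheses (K_sym : forall m n, K m n = K n m) (K_homog : forall m n, K m n \is N.-homog)
  (K_div : forall n, \sum_m 'X_m * K m n = 0).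

Lemma mderiv_var (a b : 'I_4) : ('X_a : S)^`M(b) = (a == b)%:R.
Proof.
rewrite mderivX mnm1E; have [->|] := eqVneq a b; last by rewrite scale0r.
have -> : (U_(b) - U_(b))%MM = 0%MM :> 'X_{1..4} by apply/mnmP => i; rewrite mnmBE mnm0E subnn.
by rewrite mpolyX0 scale1r.
Qed.

Lemma sum_var (b : 'I_4) (f : 'I_4 -> S) : \sum_a (a == b)%:R * f a = f b.
Proof.
rewrite (bigD1 b) //= big1 ?addr0 => [|a ab]; first by rewrite eqxx mul1r.
by rewrite (negbTE ab) mul0r.
Qed.

Lemma div_mderiv b n : \sum_a 'X_a * (K a n)^`M(b) = - K b n.
Proof.
have := congr1 (mderiv b) (K_div n); rewrite raddf_sum raddf0 /=.
under eq_bigr => a _ do rewrite mderivM mderiv_var.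
by rewrite big_split /= sum_var => /eqP; rewrite addrC addr_eq0 => /eqP.
Qed.

Lemma div_mderiv2 b c n :
  \sum_a 'X_a * (K a n)^`M(b)^`M(c) = - (K b n)^`M(c) - (K c n)^`M(b).
Proof.
have := congr1 (mderiv c) (div_mderiv b n); rewrite raddf_sum mderivN /=.
under eq_bigr => a _ do rewrite mderivM mderiv_var.
by rewrite big_split /= sum_var => <-; rewrite [RHS]addrC addKr.
Qed.

Lemma euler2 b c : \sum_a 'X_a * (K b c)^`M(a) = N%:R *: K b c.
Proof. exact: euler. Qed.

Lemma euler_mderiv b c d : \sum_a 'X_a * (K b c)^`M(a)^`M(d) = (N%:R - 1) *: (K b c)^`M(d).
Proof.
have := congr1 (mderiv d) (euler2 b c); rewrite raddf_sum mderivZ /=.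
under eq_bigr => a _ do rewrite mderivM mderiv_var.
by rewrite big_split /= sum_var scalerBl scale1r => <-; rewrite [RHS]addrC addKr.
Qed.

(** By Euler's identity and the differentiated divergence condition, the four terms contribute
    [1 - N], [-N(N-1)], [-2] and [1 - N] times [K b d]. *)
Lemma curvature_coef b d :
  \sum_a \sum_c ('X_c * 'X_a * ((K a d)^`M(b)^`M(c) - (K b d)^`M(a)^`M(c)
                              - (K a c)^`M(b)^`M(d) + (K b c)^`M(a)^`M(d)))
  = - (N%:R * (N%:R + 1)) *: K b d.
Proof.
transitivity (\sum_c 'X_c * \sum_a 'X_a * (K a d)^`M(b)^`M(c)
            - \sum_c 'X_c * \sum_a 'X_a * (K b d)^`M(a)^`M(c)
            - \sum_c 'X_c * \sum_a 'X_a * (K a c)^`M(b)^`M(d)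
            + \sum_a 'X_a * \sum_c 'X_c * (K c b)^`M(a)^`M(d)).
  rewrite -!sumrB exchange_big /= [X in _ + X](eq_bigr (fun a => \sum_c 'X_a * ('X_c * (K c b)^`M(a)^`M(d)))).
    rewrite [X in _ + X]exchange_big -big_split; apply: eq_bigr => c _ /=.
    rewrite !mulr_sumr -!sumrB -big_split; apply: eq_bigr => a _ /=.
    by rewrite [K c b]K_sym; ring.
  by move=> a _; rewrite mulr_sumr.
have E1 : \sum_c 'X_c * (\sum_a 'X_a * (K a d)^`M(b)^`M(c)) = - (N%:R *: K b d) + K b d.
  under eq_bigr => c _ do rewrite div_mderiv2 mulrDr !mulrN.
  by rewrite sumrB sumrN euler2 div_mderiv opprK.
have E2 : \sum_c 'X_c * (\sum_a 'X_a * (K b d)^`M(a)^`M(c)) = (N%:R - 1) *: (N%:R *: K b d).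
  by under eq_bigr => c _ do rewrite euler_mderiv -scalerAr; rewrite -scaler_sumr euler2.
have E3 : \sum_c 'X_c * (\sum_a 'X_a * (K a c)^`M(b)^`M(d)) = K b d + K b d.
  under eq_bigr => c _ do rewrite div_mderiv2 mulrDr !mulrN [K b c]K_sym [K d c]K_sym.
  by rewrite sumrB sumrN !div_mderiv !opprK [K d b]K_sym.
have E4 : \sum_a 'X_a * (\sum_c 'X_c * (K c b)^`M(a)^`M(d)) = K b d - N%:R *: K b d.
  under eq_bigr => a _ do rewrite div_mderiv2 mulrDr !mulrN.
  by rewrite sumrB sumrN euler2 div_mderiv opprK [K d b]K_sym.
rewrite E1 E2 E3 E4 -!mul_mpolyC; ring.
Qed.
End Divergence.

(** * Linearized gravity *)

Section Gravity.
Variable F : numClosedFieldType.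
Local Notation S := {mpoly F[4]}.
Local Notation P := (jetalg F).
Local Notation QP := (@QP F).
Local Notation dP := (@dP F).
Local Notation jet := (jet F).
Local Notation eta := (eta F).
Local Notation e k := (eta k k).
Implicit Types (a b c d i j k m n : 'I_4) (x y : P).

Definition jU n : P := jet (fU n, [::]).
Definition jT n : P := jet (fUt n, [::]).
Definition jH m n : P := jet (fH m n, [::]).
Definition trH : P := \sum_k e k *: jH k k.
(* Locked so that linearity rewrites do not see through it. *)
Definition hat : 'I_4 -> 'I_4 -> P :=
  locked (fun m n => jH m n - (eta m n / 2%:R) *: trH).
Lemma hatE m n : hat m n = jH m n - (eta m n / 2%:R) *: trH.
Proof. by rewrite /hat -lock. Qed.
Definition trhat : P := \sum_k e k *: hat k k.
Definition divU : P := \sum_r e r *: dP r (jU r).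
Let c0 : F := - 'i / 2%:R.

Lemma two_neq0 : 2%:R != 0 :> F. Proof. by rewrite pnatr_eq0. Qed.

Lemma scale_swap (V : lmodType F) (s t : F) (x : V) : s *: (t *: x) = t *: (s *: x).
Proof. by rewrite !scalerA mulrC. Qed.
Lemma scale_half (V : lmodType F) (s : F) (x : V) : (s / 2%:R) *: x = 2%:R^-1 *: (s *: x).
Proof. by rewrite scalerA mulrC. Qed.
Lemma scale_halfD (V : lmodType F) (x : V) : 2%:R^-1 *: (x + x) = x.
Proof. by rewrite -mulr2n -scaler_nat scalerA mulVf ?scale1r ?two_neq0. Qed.

Lemma sum_eta (V : lmodType F) m (f : 'I_4 -> V) : \sum_n eta m n *: f n = e m *: f m.
Proof.
rewrite (bigD1 m) //= big1 ?addr0 // => n nm.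
by rewrite /Defs.eta eq_sym (negbTE nm) scale0r.
Qed.

Lemma jH_sym m n : jH m n = jH n m. Proof. exact: jet_hsym. Qed.
Lemma hat_sym m n : hat m n = hat n m. Proof. by rewrite !hatE jH_sym eta_sym. Qed.

Lemma sum_eta_sq (x : P) : \sum_k e k *: (e k *: x) = x + x + x + x.
Proof.
under eq_bigr do rewrite scalerA eta_sq scale1r.
by rewrite sumr_const card_ord !mulrS mulr0n addr0 !addrA.
Qed.

(** In dimension 4 half the metric has trace 2, so trace reversal flips the sign of the trace and is
    an involution. *)
Lemma trhatE : trhat = - trH.
Proof.
rewrite /trhat; under eq_bigr => k _ do rewrite hatE scalerBr scale_half scale_swap.
rewrite sumrB -/trH -scaler_sumr sum_eta_sq -addrA scale_halfD.
by rewrite opprD addrA subrr sub0r.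
Qed.

Lemma jH_hat m n : jH m n = hat m n - (eta m n / 2%:R) *: trhat.
Proof. by rewrite trhatE scalerN opprK hatE subrK. Qed.

Lemma QP_U n : QP (jU n) = 0. Proof. exact: QP_jet. Qed.
Lemma QP_H m n : QP (jH m n) = c0 *: (dP m (jU n) + dP n (jU m) - eta m n *: divU).
Proof. exact: QP_jet. Qed.
Lemma QP_T m : QP (jT m) = 'i *: \sum_n e n *: dP n (jH m n).
Proof. exact: QP_jet. Qed.

Lemma QP_trH : QP trH = - c0 *: (divU + divU).
Proof.
rewrite /trH QP_sum.
under eq_bigr => k _ do rewrite QPZ QP_H scale_swap [e k *: (_ - _)]scalerBr [e k *: (_ + _)]scalerDr.
rewrite -scaler_sumr sumrB big_split /= -/divU sum_eta_sq scaleNr -scalerN; congr (_ *: _).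
by rewrite -[X in _ - X]addrA opprD addrA subrr sub0r.
Qed.

(** Trace reversal absorbs the divergence term of [dQ h]; what remains is the symmetrized gradient
    of a linearized diffeomorphism. *)
Lemma QP_hat m n : QP (hat m n) = c0 *: (dP m (jU n) + dP n (jU m)).
Proof.
rewrite hatE QPB QPZ QP_H QP_trH.
have -> : (eta m n / 2%:R) *: (- c0 *: (divU + divU)) = - (c0 *: (eta m n *: divU)).
  by rewrite scaleNr scalerN scale_swap scale_half scalerDr scale_halfD.
by rewrite opprK -scalerDr subrK.
Qed.

Definition QP_exact x : Prop := exists y, x = QP y.
Lemma exact0 : QP_exact 0. Proof. by exists 0; rewrite linear0. Qed.
Lemma exactD x y : QP_exact x -> QP_exact y -> QP_exact (x + y).
Proof. by move=> [a ->] [b ->]; exists (a + b); rewrite QPD. Qed.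
Lemma exactZ (t : F) x : QP_exact x -> QP_exact (t *: x).
Proof. by move=> [a ->]; exists (t *: a); rewrite QPZ. Qed.
Lemma exactN x : QP_exact x -> QP_exact (- x).
Proof. by rewrite -scaleN1r; apply: exactZ. Qed.
Lemma exactB x y : QP_exact x -> QP_exact y -> QP_exact (x - y).
Proof. by move=> hx hy; apply/exactD/exactN. Qed.
Lemma exact_dP k x : QP_exact x -> QP_exact (dP k x).
Proof. by move=> [a ->]; exists (dP k a); rewrite QP_dP. Qed.
Lemma exact_dseq s x : QP_exact x -> QP_exact (dseq s x).
Proof. by move=> h; elim: s => //= k s; apply: exact_dP. Qed.
Lemma exact_act f x : QP_exact x -> QP_exact (act f x).
Proof. by move=> [a ->]; exists (act f a); rewrite QP_act. Qed.
Lemma exact_sum (I : Type) (r : seq I) (p : pred I) (f : I -> P) :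
  (forall l : I, p l -> QP_exact (f l)) -> QP_exact (\sum_(l <- r | p l) f l).
Proof. by move=> h; apply: big_ind => //; [apply: exact0 | apply: exactD]. Qed.

Definition divhat m : P := \sum_k e k *: dP k (hat k m).

(* The anti-ghosts make the harmonic gauge condition exact. *)
Lemma QP_T_hat m : QP (jT m) = 'i *: (divhat m - 2%:R^-1 *: dP m trhat).
Proof.
rewrite QP_T; congr (_ *: _).
under eq_bigr => n _ do rewrite jH_hat dPB dPZ scalerBr scale_half scale_swap hat_sym.
rewrite sumrB -/(divhat m) -scaler_sumr; congr (_ - _ *: _).
under eq_bigr => n _ do rewrite scale_swap.
by rewrite sum_eta scalerA eta_sq scale1r.
Qed.

Lemma divhat_exact m : exists2 y, QP_exact y & divhat m = 2%:R^-1 *: dP m trhat + y.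
Proof.
exists (divhat m - 2%:R^-1 *: dP m trhat); last by rewrite addrC subrK.
exists (- 'i *: jT m); rewrite QPZ QP_T_hat scalerA mulNr -expr2 sqrCi opprK scale1r.
by [].
Qed.

Lemma hat_wave m n : \sum_k e k *: dP k (dP k (hat m n)) = 0.
Proof.
under eq_bigr => k _ do rewrite hatE !(dPB, dPZ) scalerBr scale_swap.
rewrite sumrB dP_wave sub0r -scaler_sumr [X in _ *: X](_ : _ = 0) ?scaler0 ?oppr0 //.
under eq_bigr => k _ do rewrite /trH !dP_sum scaler_sumr.
rewrite exchange_big /= big1 // => l _.
under eq_bigr => k _ do rewrite !dPZ scale_swap.
by rewrite -scaler_sumr dP_wave scaler0.
Qed.

(** The curvature once the two mixed second derivatives of [hat a b] in [Riem] have cancelled. *)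
Definition Rp a b c d : P :=
  (dP c (dP b (hat a d)) - dP c (dP a (hat b d)))
  - (dP d (dP b (hat a c)) - dP d (dP a (hat b c))).

Lemma cls_hhat m n : cls (hhat F m n) = hat m n.
Proof.
rewrite /hhat cls_sub clsZ /htr cls_esum4 hatE /trH; congr (_ - _ *: _).
by apply: eq_bigr => k _; rewrite clsZ.
Qed.

Lemma cls_Riem a b c d : cls (Riem F a b c d) = Rp a b c d.
Proof.
have hG m n r : cls (Gam F m n r) = dP r (hat m n) + (dP n (hat m r) - dP m (hat n r)).
  by rewrite /Gam cls_sub clsD !cls_dd !cls_hhat addrA.
rewrite /Riem cls_sub !cls_dd !hG !(dPB, dPD)  [dP c (dP d (hat a b))]dPC.
by rewrite opprD addrACA subrr add0r.
Qed.

Lemma cls_dds s (a : expr F) : cls (dds s a) = dseq s (cls a).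
Proof. by elim: s => //= i s IH; rewrite cls_dd IH. Qed.

Lemma Rp_antisym12 a b c d : Rp b a c d = - Rp a b c d.
Proof. by rewrite /Rp !opprB addrC. Qed.
Lemma Rp_antisym34 a b c d : Rp a b d c = - Rp a b c d.
Proof. by rewrite /Rp [RHS]opprB !opprB addrC. Qed.
Lemma Rp_pair a b c d : Rp a b c d = Rp c d a b.
Proof.
rewrite /Rp (hat_sym c b) (hat_sym d b) (hat_sym c a) (hat_sym d a).
rewrite (dPC a d) (dPC a c) (dPC b d) (dPC b c) !opprB.
by rewrite addrACA [RHS]addrACA; congr (_ + _); apply: addrC.
Qed.
Lemma Rp_diag12 a c d : Rp a a c d = 0.
Proof. by rewrite /Rp !subrr. Qed.
Lemma Rp_diag34 a b c : Rp a b c c = 0.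
Proof. by rewrite /Rp subrr. Qed.

Lemma sum_dP b (f : 'I_4 -> P) : \sum_k e k *: dP b (f k) = dP b (\sum_k e k *: f k).
Proof. by rewrite dP_sum; apply: eq_bigr => k _; rewrite dPZ. Qed.

(** The wave equation removes one term. Up to exact terms, each of the two divergences of [hat] is
    half a gradient of the trace, and together they cancel the second derivative of the trace. *)
Lemma Ricci_exact b d : QP_exact (\sum_k e k *: Rp k b k d).
Proof.
have -> : \sum_k e k *: Rp k b k d = dP b (divhat d) - (dP d (dP b trhat) - dP d (divhat b)).
  rewrite /Rp; under eq_bigr => k _ do rewrite !scalerBr (dPC k b) (hat_sym b k).
  by rewrite !sumrB hat_wave subr0 !sum_dP.
have [y hy ->] := divhat_exact d; have [z hz ->] := divhat_exact b.
rewrite !dPD !dPZ (dPC b d) opprB addrA [_ + dP b y + _]addrACA -scalerDr scale_halfD.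
by rewrite addrAC subrr add0r; apply: exactD; apply: exact_dP.
Qed.

(** The two halves of the triple derivative of the trace cancel by antisymmetry in [c] and [d]; the
    wave equation removes the other terms. *)
Lemma Bianchi_exact b c d : QP_exact (\sum_k e k *: dP k (Rp k b c d)).
Proof.
have -> : \sum_k e k *: dP k (Rp k b c d) = dP c (dP b (divhat d)) - dP d (dP b (divhat c)).
  rewrite /Rp; under eq_bigr => k _.
    rewrite !dPB !scalerBr !(dPC k c) !(dPC k d) !(dPC k b).
    over.
  by rewrite !sumrB !sum_dP !hat_wave (linear0 (dP c)) (linear0 (dP d)) !subr0.
have [y hy ->] := divhat_exact d; have [z hz ->] := divhat_exact c.
rewrite !dPD !dPZ (dPC b d) (dPC b c) (dPC c d) opprD addrACA subrr add0r.
by apply: exactB; do 2!apply: exact_dP.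
Qed.

Lemma Rp_wave a b c d : \sum_k e k *: dP k (dP k (Rp a b c d)) = 0.
Proof.
have w i j m n : \sum_k e k *: dP k (dP k (dP i (dP j (hat m n)))) = 0.
  under eq_bigr => k _ do rewrite !(dPC k i) !(dPC k j).
  by rewrite !sum_dP hat_wave !linear0.
by under eq_bigr => k _ do rewrite !dPB !scalerBr; rewrite !sumrB !w !subr0.
Qed.

Lemma set_nth_perm (t : seq 'I_4) (j : nat) : (j < size t)%N ->
  exists t', forall x : 'I_4, perm_eq (set_nth ord0 t j x) (x :: t').
Proof.
elim: t j => [|a t IH] [|j] //= h; first by exists t.
have [t' ht'] := IH j h; exists (a :: t') => x.
apply: (@perm_trans _ [:: a, x & t']); first by rewrite perm_cons.
exact/permEl/(perm_catCA [:: a] [:: x] t').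
Qed.

Lemma set2_perm (t : seq 'I_4) (i j : nat) : (i < j)%N -> (j < size t)%N ->
  exists t', forall x : 'I_4, perm_eq (set2 t i j x) [:: x, x & t'].
Proof.
elim: t i j => [|a t IH] [|i] [|j] //= ij h.
  by have [t' ht'] := set_nth_perm h; exists t' => x; rewrite /set2 /= perm_cons.
have [t' ht'] := IH i j ij h; exists (a :: t') => x.
apply: (@perm_trans _ [:: a, x, x & t']); first by rewrite perm_cons; apply: ht'.
exact/permEl/(perm_catCA [:: a] [:: x; x] t').
Qed.

Lemma cls_dRtens a b c d t : cls (dRtens F [:: a, b, c, d & t]) = dseq t (Rp a b c d).
Proof. by rewrite /dRtens cls_dds cls_Riem /= drop0. Qed.

Lemma sum_dseq t (f : 'I_4 -> P) : \sum_k e k *: dseq t (f k) = dseq t (\sum_k e k *: f k).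
Proof. by rewrite linear_sum; apply: eq_bigr => k _; rewrite linearZ. Qed.

(** The positions decide: two curvature indices give zero or the Ricci tensor up to sign, one
    curvature and one derivative index give a divergence of the curvature, and two derivative
    indices give the wave operator. *)
Lemma trace_exact (n : nat) s (i j : nat) : size s = (4 + n)%N -> (i < j)%N -> (j < 4 + n)%N ->
  QP_exact (cls (trace_at (dRtens F) i j s)).
Proof.
case: s => [|a [|b [|c [|d t]]]] // [hs] ij jn; rewrite cls_trace_at.
have exN (f g : 'I_4 -> P) : (forall k, f k = - g k) -> QP_exact (\sum_k e k *: g k) ->
    QP_exact (\sum_k e k *: f k).
  move=> fg /exactN; rewrite -sumrN; congr QP_exact; apply: eq_bigr => k _.
  by rewrite fg scalerN.
have ex0 (f : 'I_4 -> P) : (forall k, f k = 0) -> QP_exact (\sum_k e k *: f k).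
  by move=> f0; rewrite big1 => [|k _]; [apply: exact0 | rewrite f0 scaler0].
have [j4|] := ltnP j 4.
  case: i j ij j4 {jn} => [|[|[|i]]] [|[|[|[|j]]]] // _ _;
    under eq_bigr => k _ do rewrite cls_dRtens; rewrite sum_dseq; apply: exact_dseq.
  - by apply: ex0 => k; apply: Rp_diag12.
  - exact: Ricci_exact.
  - by apply: exN (Ricci_exact b c) => k; apply: Rp_antisym34.
  - by apply: exN (Ricci_exact a d) => k; apply: Rp_antisym12.
  - by apply: exN (exN _ _ _ (Ricci_exact a c)) => k; [apply: Rp_antisym34 | apply: Rp_antisym12].
  - by apply: ex0 => k; apply: Rp_diag34.
case: j ij jn => [|[|[|[|j]]]] // ij jn _.
have jt : (j < size t)%N by rewrite hs.
have [i4|] := ltnP i 4.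
  have [t' ht'] := set_nth_perm jt.
  have pull (f : 'I_4 -> P) : QP_exact (\sum_k e k *: dP k (f k)) ->
      QP_exact (\sum_k e k *: dseq (set_nth ord0 t j k) (f k)).
    move=> h; under eq_bigr => k _ do rewrite (dseq_perm _ (ht' k)) dseq_cons -dseq_dP.
    by rewrite sum_dseq; apply: exact_dseq.
  case: i ij i4 => [|[|[|[|i]]]] // _ _;
    under eq_bigr => k _ do rewrite cls_dRtens; apply: pull.
  - exact: Bianchi_exact.
  - by apply: exN (Bianchi_exact a c d) => k; rewrite Rp_antisym12 linearN.
  - under eq_bigr => k _ do rewrite Rp_pair; exact: Bianchi_exact.
  - apply: exN (Bianchi_exact c a b) => k; by rewrite Rp_pair Rp_antisym12 linearN.
case: i ij => [|[|[|[|i]]]] // ij _.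
have [t' ht'] := @set2_perm t i j ij jt.
under eq_bigr => k _.
  rewrite cls_dRtens -/(set2 t i j k) (dseq_perm _ (ht' k)) !dseq_cons -!dseq_dP.
  over.
rewrite sum_dseq Rp_wave linear0; exact: exact0.
Qed.

Lemma dP_bw k (b : bool) w x : lspan (jetbw b w) x -> lspan (@jetbw F b w.+1) (dP k x).
Proof.
apply: (lspan_linear (f := dP k)) => y [[f s] [h1 h2 ->]] /=; rewrite dP_jet.
by apply: lspan_gen; exists (f, k :: s); split=> //; rewrite -h2 /wt /= addSn.
Qed.

Lemma hat_bw m n : lspan (jetbw false 1) (hat m n).
Proof.
have h a b : lspan (jetbw false 1) (jH a b) by apply: lspan_gen; exists (fH a b, [::]).
rewrite hatE; apply: lspanD => //; apply/lspanN/lspanZ/lspan_sum => k _; exact: lspanZ.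
Qed.

(** The weight counts [n] outer derivatives, two inside the curvature, and the shift 1 of [h] in
    [wt]. *)
Lemma dRtens_bw (n : nat) s : size s = (4 + n)%N -> lspan (jetbw false (n + 3)) (cls (dRtens F s)).
Proof.
case: s => [|a [|b [|c [|d t]]]] // [hs]; rewrite cls_dRtens -(hs : size t = n) {n hs}.
elim: t => [|k t IH] /=; last by rewrite addSn; apply: dP_bw.
by apply/lspanD; [|apply/lspanN]; apply/lspanD; try apply/lspanN; do 2!apply: dP_bw; apply: hat_bw.
Qed.

Lemma R0_diff (n : nat) s : size s = (4 + n)%N ->
  QP_exact (cls (dRtens F s) - cls (R0 F n s)) /\ lspan (jetbw false (n + 3)) (cls (R0 F n s)).
Proof.
move=> hs; have h := traceless_part_diff (dRtens F) hs; split.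
  elim: h => [|t x y [i [j [s' [ij jk hs' ->]]]] _ IH]; first exact: exact0.
  by apply: exactD IH; apply: exactZ; apply: trace_exact hs' ij jk.
have -> : cls (R0 F n s) = cls (dRtens F s) - (cls (dRtens F s) - cls (R0 F n s)).
  by rewrite opprB addrC subrK.
apply: lspanD; first exact: dRtens_bw.
apply: lspanN; apply: (lspan_linear (f := idfun)) h => x [i [j [s' [ij jk hs' ->]]]] /=.
rewrite cls_trace_at; apply: lspan_sum => k _; apply/lspanZ/dRtens_bw.
by apply: size_set2 => //; apply: ltn_trans jk.
Qed.

(** * Linear jets modulo targets and exact elements *)

Definition target x : Prop := exists2 t, target_gen t & x = cls t.
(** Targets enter only linearly here, whereas the primitive [y] may be any element of [P]. *)
Definition cohomologous_to_target x : Prop := exists w y, lspan target w /\ x = w + QP y.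
Local Notation TE := cohomologous_to_target.

Lemma TE_exact x : QP_exact x -> TE x.
Proof. by move=> [y ->]; exists 0, y; split; [apply: lspan0 | rewrite add0r]. Qed.
Lemma TE_target x : target x -> TE x.
Proof. by exists x, 0; split; [apply: lspan_gen | rewrite linear0 addr0]. Qed.
Lemma TE0 : TE 0. Proof. exact/TE_exact/exact0. Qed.
Lemma TED x y : TE x -> TE y -> TE (x + y).
Proof.
move=> [w [z [hw ->]]] [w' [z' [hw' ->]]]; exists (w + w'), (z + z').
by rewrite QPD addrACA; split=> //; apply: lspanD.
Qed.
Lemma TEZ (t : F) x : TE x -> TE (t *: x).
Proof.
move=> [w [z [hw ->]]]; exists (t *: w), (t *: z).
by rewrite QPZ scalerDr; split=> //; apply: lspanZ.
Qed.
Lemma TE_sum (I : Type) (r : seq I) (p : pred I) (f : I -> P) :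
  (forall l : I, p l -> TE (f l)) -> TE (\sum_(l <- r | p l) f l).
Proof. by move=> h; apply: big_ind => //; [apply: TE0 | apply: TED]. Qed.

Lemma cls_uu m n : cls (uu F m n) = 2%:R^-1 *: (dP m (jU n) - dP n (jU m)).
Proof. by rewrite /uu clsZ div1r cls_sub !cls_dd. Qed.

Lemma target_bw x : target x -> exists (b : bool) w, lspan (@jetbw F b w) x.
Proof.
have hU n : lspan (@jetbw F true 0) (jU n) by apply: lspan_gen; exists (fU n, [::]).
move=> [t [[m ->]|[[m [n ->]]|[n [s [hs ->]]]]] ->].
- by exists true, 0%N; apply: hU.
- exists true, 1%N; rewrite cls_uu; apply/lspanZ/lspanD; last apply: lspanN; exact: dP_bw.
- by exists false, (n + 3)%N; have [] := R0_diff hs.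
Qed.

Lemma TE_Riem s a b c d : TE (dseq s (Rp a b c d)).
Proof.
have hs : size [:: a, b, c, d & s] = (4 + size s)%N by [].
have [h _] := R0_diff hs.
rewrite -cls_dRtens -[cls _](subrK (cls (R0 F (size s) [:: a, b, c, d & s]))).
apply: TED; first exact: TE_exact.
by apply: TE_target; exists (R0 F (size s) [:: a, b, c, d & s]) => //; right; right; exists (size s), [:: a, b, c, d & s].
Qed.

Lemma TE_act_Riem f a b c d : TE (act f (Rp a b c d)).
Proof. by apply: TE_sum => m _; apply/TEZ/TE_Riem. Qed.

Lemma c0_neq0 : c0 != 0.
Proof. by rewrite mulf_neq0 ?oppr_eq0 ?neq0Ci // invr_eq0 two_neq0. Qed.

Lemma sym_dU_exact a n : QP_exact (dP a (jU n) + dP n (jU a)).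
Proof.
by exists (c0^-1 *: hat a n); rewrite QPZ QP_hat -/c0 scalerA mulVf ?c0_neq0 // scale1r.
Qed.

(** The Christoffel combination: second derivatives of [u] are combinations of first derivatives of
    the symmetrized gradient, which is exact; the same identity shows that Killing fields of flat
    space are affine. *)
Lemma ddU_exact a b n : QP_exact (dP a (dP b (jU n))).
Proof.
pose s i j := dP i (jU j) + dP j (jU i).
have E : dP a (dP b (jU n)) = 2%:R^-1 *: (dP a (s b n) + dP b (s a n) - dP n (s a b)).
  rewrite /s !dPD (dPC n a) (dPC n b) (dPC b a) [X in X + _ - _]addrC.
  rewrite [dP a (dP b _) + dP b _]addrC opprD addrACA.
  set p := dP a (dP n _); set q := dP b (dP n _); set r := dP a (dP b _).
  by rewrite (addrAC p) subrr add0r [_ - q]addrAC subrr add0r scale_halfD.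
by rewrite E; apply/exactZ/exactB; [apply: exactD|]; apply/exact_dP/sym_dU_exact.
Qed.

Lemma TE_U s n : TE (dseq s (jU n)).
Proof.
case: s => [|a [|b s]].
- by apply: TE_target; exists (Var (fU n, [::])) => //; left; exists n.
- have -> : dseq [:: a] (jU n) =
      2%:R^-1 *: (dP a (jU n) - dP n (jU a)) + 2%:R^-1 *: (dP a (jU n) + dP n (jU a)).
    by rewrite -scalerDr addrCA subrK scale_halfD.
  apply: TED; last exact/TE_exact/exactZ/sym_dU_exact.
  by apply: TE_target; exists (uu F a n); [right; left; exists a, n | rewrite cls_uu].
- by rewrite !dseq_cons -!dseq_dP; apply/TE_exact/exact_dseq/ddU_exact.
Qed.

Lemma TE_act_U f n : TE (act f (jU n)).
Proof. by apply: TE_sum => m _; apply/TEZ/TE_U. Qed.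

Definition sum4 (G : 'I_4 -> 'I_4 -> 'I_4 -> 'I_4 -> P) : P :=
  \sum_a \sum_b \sum_c \sum_d G a b c d.

Lemma eq_sum4 G G' : (forall a b c d, G a b c d = G' a b c d) -> sum4 G = sum4 G'.
Proof. by move=> h; do 4!(apply: eq_bigr => ? _). Qed.
Lemma sum4_swap12 G : sum4 G = sum4 (fun a b c d => G b a c d).
Proof. exact: exchange_big. Qed.
Lemma sum4_swap34 G : sum4 G = sum4 (fun a b c d => G a b d c).
Proof. by do 2!(apply: eq_bigr => ? _); apply: exchange_big. Qed.
Lemma sum4B G G' : sum4 (fun a b c d => G a b c d - G' a b c d) = sum4 G - sum4 G'.
Proof. by rewrite -sumrB; do 3!(apply: eq_bigr => ? _; rewrite -sumrB). Qed.
Lemma sum4_24 (g : 'I_4 -> 'I_4 -> 'I_4 -> 'I_4 -> S) (h : 'I_4 -> 'I_4 -> P) :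
  sum4 (fun a b c d => act (g a b c d) (h b d)) =
  \sum_b \sum_d act (\sum_a \sum_c g a b c d) (h b d).
Proof.
rewrite /sum4 exchange_big; apply: eq_bigr => b _.
under eq_bigr => a _ do rewrite exchange_big.
rewrite exchange_big; apply: eq_bigr => d _ /=.
by rewrite act_suml; apply: eq_bigr => a _; rewrite act_suml.
Qed.

(* Poincare lemma: a divergence-free symmetric K is a second divergence, whose
   pairing with [hat] is a pairing with the curvature. *)
Lemma TE_div_free_homog (K : 'I_4 -> 'I_4 -> S) N :
  (forall m n, K m n = K n m) -> (forall m n, K m n \is N.-homog) ->
  (forall n, \sum_m 'X_m * K m n = 0) ->
  TE (\sum_m \sum_n act (K m n) (hat m n)).
Proof.
(* Degree 0 is separate because the factor [N(N+1)] vanishes there; a constant divergence-free [K]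
   is zero. *)
move=> Ks Kh Kd; case: N Kh => [|N] Kh.
  rewrite big1; first exact: TE0.
  move=> m _; rewrite big1 // => n _; have := div_mderiv Kd m n.
  rewrite big1 => [/esym/eqP|a _]; last by rewrite mderiv_homog0 ?mulr0.
  by rewrite oppr_eq0 => /eqP ->; rewrite act0.
have E : sum4 (fun a b c d => act ((K b d)^`M(a)^`M(c)) (Rp a b c d)) =
    - (N.+1%:R * (N.+1%:R + 1)) *: \sum_m \sum_n act (K m n) (hat m n).
  pose f a b c d := (K b d)^`M(a)^`M(c).
  have E0 a b c d : act (f a b c d) (Rp a b c d) =
     (act ('X_c * 'X_b * f a b c d) (hat a d) - act ('X_c * 'X_a * f a b c d) (hat b d))
     - (act ('X_d * 'X_b * f a b c d) (hat a c) - act ('X_d * 'X_a * f a b c d) (hat b c)).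
    have E1 i j x : act (f a b c d) (dP i (dP j x)) = act ('X_i * 'X_j * f a b c d) x.
      by rewrite !act_dP mulrCA mulrA.
    by rewrite /Rp !linearB /= !E1.
  rewrite (eq_sum4 E0) !sum4B.
  (* Renaming summation indices turns all four terms into coefficients of [hat b d], so that the
     antisymmetries of the curvature are carried by the second derivatives of [K]. *)
  rewrite [X in X - _ - _]sum4_swap12 [X in _ - (X - _)]sum4_swap12 [X in _ - (X - _)]sum4_swap34.
  rewrite [X in _ - (_ - X)]sum4_swap34 -!sum4B.
  rewrite (eq_sum4 (G' := fun a b c d => act ('X_c * 'X_a * (f b a c d - f a b c d
      - f b a d c + f a b d c)) (hat b d))); last first.
    move=> a b c d; rewrite !(mulrDr, mulrN) !(actD, actN) opprB -!addrA; congr (_ + (_ + _)).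
    by rewrite addrC.
  rewrite sum4_24 scaler_sumr; apply: eq_bigr => b _; rewrite scaler_sumr.
  by apply: eq_bigr => d _; rewrite /f (curvature_coef Ks Kh Kd) actZ.
have nz : - (N.+1%:R * (N.+1%:R + 1)) != 0 :> F.
  by rewrite oppr_eq0 mulf_neq0 ?natr1 ?pnatr_eq0.
rewrite -[X in TE X](scalerK nz) -E; apply: TEZ.
by do 4!(apply: TE_sum => ? _); apply: TE_act_Riem.
Qed.

(** Multiplication by a variable raises the degree by one, so the homogeneous components of [K] are
    divergence-free separately. *)
Lemma TE_div_free (K : 'I_4 -> 'I_4 -> S) :
  (forall m n, K m n = K n m) -> (forall n, \sum_m 'X_m * K m n = 0) ->
  TE (\sum_m \sum_n act (K m n) (hat m n)).
Proof.
move=> Ks Kd; pose k := (\max_(p : 'I_4 * 'I_4) msize (K p.1 p.2))%N.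
have E m n : K m n = \sum_(d < k) pihomog mdeg d (K m n).
  apply: pihomog_partitionE.
  exact: (@leq_bigmax _ (fun p : 'I_4 * 'I_4 => msize (K p.1 p.2)) (m, n)).
have -> : \sum_m \sum_n act (K m n) (hat m n) =
    \sum_(d < k) \sum_m \sum_n act (pihomog mdeg d (K m n)) (hat m n).
  rewrite [RHS]exchange_big; apply: eq_bigr => m _; rewrite [RHS]exchange_big; apply: eq_bigr => n _.
  by rewrite {1}E act_suml.
apply: TE_sum => d _; apply: (@TE_div_free_homog _ d).
- by move=> m n; rewrite Ks.
- by move=> m n; apply: pihomogP.
- move=> n; under eq_bigr => m _ do rewrite -pihomog_mulX.
  by rewrite -raddf_sum Kd raddf0.
Qed.

(** Coefficients are taken against [hat] in place of [h] because its variation has no trace term. *)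
Definition lincomb (C : 'I_4 -> S) (K : 'I_4 -> 'I_4 -> S) (D : 'I_4 -> S) : P :=
  \sum_m act (C m) (jT m) + \sum_m \sum_n act (K m n) (hat m n) + \sum_n act (D n) (jU n).

Lemma act_delta f m (h : 'I_4 -> P) : \sum_k act (if k == m then f else 0) (h k) = act f (h m).
Proof.
rewrite (bigD1 m) //= eqxx big1 ?addr0 // => k /negbTE ->.
exact: act0.
Qed.

Lemma lincomb_exists x : lspan (fun y => exists g : gen, y = jet g) x ->
  exists C K D, x = lincomb C K D /\ forall m n, K m n = K n m.
Proof.
have z1 (h : 'I_4 -> P) : \sum_k act 0 (h k) = 0 by rewrite big1 // => k _; apply: act0.
have z2 : \sum_m \sum_n act 0 (hat m n) = 0 by rewrite big1 // => m _; apply: z1.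
elim=> [|t {}x y [[fl s] ->] _ [C [K [D [-> Ks]]]]].
  by exists (fun _ => 0), (fun _ _ => 0), (fun _ => 0); rewrite /lincomb !z1 z2 !addr0.
have [g hg] := dseq_act s (jet (fl, [::])).
have [C' [K' [D' [-> Ks']]]] : exists C' K' D', jet (fl, s) = lincomb C' K' D' /\
    forall m n, K' m n = K' n m.
  rewrite jet_dseq hg {hg}; case: fl => [m n|n|m].
  (* The symmetrized unit at [(m, n)] yields [hat m n]; the second part is the trace term of
     [jH_hat]. *)
  - exists (fun _ => 0), (fun a b =>
      2%:R^-1 *: ((if b == n then if a == m then g else 0 else 0) +
                  (if b == m then if a == n then g else 0 else 0))
      - (2%:R^-1 * eta m n) *: (eta a b *: g)), (fun _ => 0).
    split; last first.
      move=> a b; rewrite [eta a b]eta_sym [X in _ *: X]addrC.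
      by case: (a == m); case: (a == n); case: (b == n); case: (b == m).
    rewrite /lincomb !z1 add0r addr0 -/(jH m n) jH_hat linearB linearZ /=.
    have d2 i j : \sum_a \sum_b act (if b == j then if a == i then g else 0 else 0) (hat a b)
        = act g (hat i j).
      by under eq_bigr => a _ do rewrite act_delta; rewrite (act_delta g i (fun a => hat a j)).
    have tr : \sum_a \sum_b eta a b *: act g (hat a b) = act g trhat.
      rewrite /trhat linear_sum; apply: eq_bigr => a _.
      by rewrite (sum_eta a (fun b => act g (hat a b))) linearZ.
    under eq_bigr => a _.
      under eq_bigr => b _ do rewrite actD actN !actZ actD.
      rewrite sumrB -!scaler_sumr big_split.
      over.
    rewrite sumrB -!scaler_sumr big_split /= !d2 tr (hat_sym n m) scale_halfD.
    by rewrite mulrC.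
  - exists (fun _ => 0), (fun _ _ => 0), (fun k => if k == n then g else 0).
    by rewrite /lincomb z1 z2 !add0r act_delta.
  - exists (fun k => if k == m then g else 0), (fun _ _ => 0), (fun _ => 0).
    by rewrite /lincomb z1 z2 !addr0 act_delta.
exists (fun m => t *: C' m + C m), (fun m n => t *: K' m n + K m n), (fun n => t *: D' n + D n).
split; last by move=> m n; rewrite Ks Ks'.
rewrite /lincomb.
under [X in _ = X + _ + _]eq_bigr => m _ do rewrite actP.
under [X in _ = _ + X + _]eq_bigr => m _.
  under eq_bigr => n _ do rewrite actP.
  rewrite big_split /= -scaler_sumr.
  over.
under [X in _ = _ + _ + X]eq_bigr => m _ do rewrite actP.
by rewrite !big_split /= -!scaler_sumr !scalerDr [LHS]addrACA [X in X + _ = _]addrACA.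
Qed.

(** [phi] selects the combination of fields whose coefficient is read off; closedness becomes one
    congruence modulo the quadric for each choice. *)
Lemma closed_relation C K D (phi : fld -> F) :
  (forall m n, phi (fH m n) = phi (fH n m)) -> QP (lincomb C K D) = 0 ->
  cong (\sum_m C m * ('i *: \sum_n e n *: ('X_n * (phi (fH m n) *: 1)))
    + \sum_m \sum_n K m n * (c0 *: ('X_m * (phi (fU n) *: 1) + 'X_n * (phi (fU m) *: 1)))) 0.
Proof.
move=> phis Q0; pose R x f := cong (linP phi x) f.
have RD x y f g : R x f -> R y g -> R (x + y) (f + g).
  by move=> hx hy; apply: cong_trans (linPD phis x y) (congD hx hy).
have RZ (t : F) x f : R x f -> R (t *: x) (t *: f).
  by move=> hx; apply: cong_trans (linPZ phis t x) (congZ t hx).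
have Rsum (f : 'I_4 -> P) (g : 'I_4 -> S) : (forall k, R (f k) (g k)) -> R (\sum_k f k) (\sum_k g k).
  by move=> h; apply: cong_trans (linP_sum phis f) (cong_sum h).
have RdP k x f : R x f -> R (dP k x) ('X_k * f).
  by move=> hx; apply: cong_trans (linP_dP phis k x) (congMl _ hx).
have Ract g x f : R x f -> R (act g x) (g * f).
  by move=> hx; apply: cong_trans (linP_act phis g x) (congMl _ hx).
have Rjet (fl : fld) : R (jet (fl, [::])) (phi fl *: 1) by apply: linP_jet.
suff h : R (QP (lincomb C K D)) (\sum_m C m * ('i *: \sum_n e n *: ('X_n * (phi (fH m n) *: 1)))
    + \sum_m \sum_n K m n * (c0 *: ('X_m * (phi (fU n) *: 1) + 'X_n * (phi (fU m) *: 1)))).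
  by apply: cong_trans (cong_sym h) _; rewrite Q0; apply: linP0.
rewrite /lincomb !QPD !QP_sum [X in _ + X]big1 ?addr0 => [|n _]; last by rewrite QP_act QP_U linear0.
apply: (RD); apply: (Rsum) => m.
  by rewrite QP_act QP_T; apply: (Ract); apply: (RZ); apply: (Rsum) => n; apply: (RZ); apply: (RdP); apply: (Rjet).
rewrite QP_sum; apply: (Rsum) => n; rewrite QP_act QP_hat.
by apply: (Ract); apply: (RZ); apply: (RD); apply: (RdP); apply: (Rjet).
Qed.

(** The coefficient of [h] at [(0, k)] gives [e_k C_0 X_k + C_k X_0 = 0] modulo the quadric.
    Cancelling [X_0] for [k = 0] makes [C_0] vanish, and then every [C_k] does. *)
Lemma QP_lincomb_antighost C K D : QP (lincomb C K D) = 0 -> forall m, act (C m) (jT m) = 0.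
Proof.
move=> Q0.
have hk k : cong (e k *: (C ord0 * 'X_k) + C k * 'X_ord0) 0.
  pose phi (y : fld) : F := if y is fH m n then ((m == ord0) && (n == k))%:R + ((m == k) && (n == ord0))%:R else 0.
  have phis m n : phi (fH m n) = phi (fH n m) by rewrite /phi addrC ![(_ == k) && _]andbC.
  have := closed_relation phis Q0; rewrite [X in _ + X]big1 ?addr0 => [|m _]; last first.
    by rewrite big1 // => n _; rewrite !scale0r !mulr0 addr0 scaler0 mulr0.
  have -> : \sum_m C m * ('i *: \sum_n e n *: ('X_n * (phi (fH m n) *: 1))) =
      'i *: (e k *: (C ord0 * 'X_k) + C k * 'X_ord0).
    have E m : \sum_n e n *: ('X_n * (phi (fH m n) *: 1)) =
        (m == ord0)%:R *: (e k *: 'X_k) + (m == k)%:R *: 'X_ord0 :> S.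
      under eq_bigr => n _ do rewrite -scalerAr mulr1 scalerDl scalerDr.
      rewrite big_split /=; congr (_ + _).
        rewrite (bigD1 k) //= big1 ?addr0 => [|n /negbTE ->]; last by rewrite andbF scale0r scaler0.
        by rewrite eqxx andbT scale_swap.
      rewrite (bigD1 ord0) //= big1 ?addr0 => [|n /negbTE ->]; last by rewrite andbF scale0r scaler0.
      by rewrite eqxx andbT [eta _ _](_ : _ = 1) ?scale1r.
    under eq_bigr => m _ do rewrite E -scalerAr mulrDr.
    rewrite -scaler_sumr big_split /=; congr (_ *: (_ + _)).
      rewrite (bigD1 ord0) //= big1 ?addr0 => [|m /negbTE ->]; last by rewrite scale0r mulr0.
      by rewrite scale1r -scalerAr.
    rewrite (bigD1 k) //= big1 ?addr0 => [|m /negbTE ->]; last by rewrite scale0r mulr0.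
    by rewrite eqxx scale1r.
  move=> /(congZ ('i^-1)); rewrite scaler0 scalerA mulVf ?neq0Ci // scale1r.
  by [].
have h0 : cong (C ord0) 0.
  apply: cong_cancel_X0; have := congZ (2%:R^-1) (hk ord0); rewrite scaler0.
  by rewrite [eta _ _](_ : _ = 1) // scale1r scale_halfD mulrC.
move=> m; apply: act_cong0; apply: cong_cancel_X0; rewrite mulrC.
have -> : C m * 'X_ord0 = e m *: (C ord0 * 'X_m) + C m * 'X_ord0 - e m *: ('X_m * C ord0).
  by rewrite ['X_m * _]mulrC addrAC subrr add0r.
have h : cong (- e m *: ('X_m * C ord0)) (- e m *: ('X_m * 0)) by apply/congZ/congMl.
by have := congD (hk m) h; rewrite mulr0 scaler0 addr0 scaleNr.
Qed.

(** By symmetry of [K], the coefficient of [u_k] in the closedness relation is a nonzero multiple of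
    the divergence of column [k]. *)
Lemma QP_lincomb_div C K D : (forall m n, K m n = K n m) -> QP (lincomb C K D) = 0 ->
  forall n, exists h, \sum_m 'X_m * K m n = x2 F * h.
Proof.
move=> Ks Q0 k.
pose phi (y : fld) : F := if y is fU n then (n == k)%:R else 0.
have := closed_relation (phi := phi) (fun _ _ => erefl) Q0.
rewrite big1 ?add0r => [|m _]; last first.
  by rewrite big1 ?scaler0 ?mulr0 // => n _; rewrite scale0r mulr0 scaler0.
have -> : \sum_m \sum_n K m n * (c0 *: ('X_m * (phi (fU n) *: 1) + 'X_n * (phi (fU m) *: 1))) =
    (c0 * 2%:R) *: \sum_m 'X_m * K m k.
  have E m n : K m n * (c0 *: ('X_m * (phi (fU n) *: 1) + 'X_n * (phi (fU m) *: 1))) =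
      c0 *: ((n == k)%:R *: ('X_m * K m n) + (m == k)%:R *: ('X_n * K n m)).
    by rewrite -scalerAr (Ks n m) -!scalerAr !mulr1 mulrDr -!scalerAr ![K m n * _]mulrC.
  under eq_bigr => m _ do under eq_bigr => n _ do rewrite E.
  under eq_bigr => m _ do rewrite -scaler_sumr big_split /=.
  rewrite -scaler_sumr -scalerA; congr (_ *: _); rewrite big_split /= scaler_nat mulr2n.
  have d (G : 'I_4 -> S) : \sum_n (n == k)%:R *: G n = G k.
    rewrite (bigD1 k) //= big1 ?addr0 => [|n /negbTE ->]; last by rewrite scale0r.
    by rewrite eqxx scale1r.
  congr (_ + _); first by apply: eq_bigr => m _; rewrite (d (fun n => 'X_m * K m n)).
  by rewrite exchange_big; apply: eq_bigr => m _; rewrite (d (fun n => 'X_m * K m n)).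
move=> /(congZ ((c0 * 2%:R)^-1)); rewrite scaler0 scalerA mulVf ?scale1r.
  by move=> [h]; rewrite subr0 => ->; exists h.
by rewrite mulf_neq0 ?c0_neq0 ?two_neq0.
Qed.

Lemma target_complete x : lspan (fun y => exists g : gen, y = jet g) x -> QP x = 0 -> TE x.
Proof.
move=> /lincomb_exists [C [K [D [-> Ks]]]] Q0.
rewrite /lincomb big1 ?add0r => [|m _]; last exact: QP_lincomb_antighost Q0 m.
apply: TED; last by apply: TE_sum => n _; apply: TE_act_U.
have /fin_all_exists [G hG] := QP_lincomb_div Ks Q0.
(* Up to the factor ['i], the coefficients against [hat] in [dQ] of the anti-ghosts with
   coefficients [2 G], symmetrized. In the divergence of [E] the terms along [X_n] cancel, which
   leaves [x2 G]. *)
pose E m n := G m * (e n *: 'X_n) + G n * (e m *: 'X_m) - eta m n *: \sum_k G k * 'X_k.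
have Es m n : E m n = E n m by rewrite /E addrC eta_sym [X in X - _]addrC addrC.
have Ediv n : \sum_m 'X_m * E m n = x2 F * G n.
  have -> : \sum_m 'X_m * E m n = \sum_m (G m * 'X_m) * (e n *: 'X_n)
      + \sum_m (e m *: ('X_m * 'X_m)) * G n - \sum_m eta n m *: ('X_m * \sum_k G k * 'X_k).
    rewrite -big_split -sumrB; apply: eq_bigr => m _ /=.
    rewrite /E mulrBr mulrDr (eta_sym F n m); congr (_ + _ - _); last by rewrite -scalerAr.
      by rewrite mulrA ['X_m * G m]mulrC.
    by rewrite mulrCA -scalerAr mulrC.
  rewrite (sum_eta n (fun m => 'X_m * \sum_k G k * 'X_k)) -!mulr_suml -/(x2 F).
  by rewrite addrAC -scalerAr [_ * 'X_n]mulrC subrr add0r.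
have -> : \sum_m \sum_n act (K m n) (hat m n) =
    \sum_m \sum_n act (K m n - E m n) (hat m n) + \sum_m \sum_n act (E m n) (hat m n).
  rewrite -big_split; apply: eq_bigr => m _; rewrite -big_split; apply: eq_bigr => n _ /=.
  by rewrite -actD subrK.
apply: TED.
  apply: TE_div_free => [m n|n]; first by rewrite Ks Es.
  by under eq_bigr do rewrite mulrBr; rewrite sumrB hG Ediv subrr.
apply: TE_exact.
have -> : \sum_m \sum_n act (E m n) (hat m n) =
    \sum_m 2%:R *: act (G m) (divhat m - 2%:R^-1 *: dP m trhat).
  have d m : act (G m) (divhat m) = \sum_n act (G m * (e n *: 'X_n)) (hat m n).
    rewrite linear_sum; apply: eq_bigr => n _.
    by rewrite linearZ /= act_dP -scalerAr actZ mulrC (hat_sym n m).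
  have t : \sum_m \sum_n act (eta m n *: \sum_k G k * 'X_k) (hat m n) = \sum_k act (G k) (dP k trhat).
    transitivity (act (\sum_k G k * 'X_k) trhat).
      rewrite linear_sum; apply: eq_bigr => m _; rewrite linearZ /=.
      by under eq_bigr do rewrite actZ; rewrite (sum_eta m (fun n => act _ (hat m n))).
    by rewrite act_suml; apply: eq_bigr => k _; rewrite act_dP mulrC.
  under eq_bigr => m _.
    under eq_bigr => n _ do rewrite actD actN actD.
    rewrite sumrB big_split /= -d.
    over.
  rewrite sumrB big_split /= t [X in _ + X - _]exchange_big /=.
  under [X in _ + X - _]eq_bigr => m _ do under eq_bigr => n _ do rewrite hat_sym.
  under [X in _ + X - _]eq_bigr => m _ do rewrite -d.
  rewrite -big_split -sumrB; apply: eq_bigr => m _ /=.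
  by rewrite linearB linearZ /= scalerBr scalerA divff ?two_neq0 // scale1r scaler_nat mulr2n.
apply: exact_sum => m _; apply/exactZ/exact_act.
have [y hy ->] := divhat_exact m; by rewrite addrC addKr.
Qed.
End Gravity.

Theorem mainTheorem4 (F : numClosedFieldType) (p : expr F) :
  peq (dQ p) (Const 0%R) ->
  exists b q : expr F, poly_in (@target_gen F) q /\ peq p (Add q (dQ b)).
Proof.
move=> /clsP; rewrite cls_dQ cls0 => hp.
pose T x := exists2 q, poly_in (@target_gen F) q & x = cls q.
have [||||t [b [[q hq ->] E]]] :=
    closed_cohomologous_of_linear (@target_bw F) (@target_complete F) (T := T) _ _ _ _ hp.
- by move=> c; exists (Const c); [apply: pi_const | rewrite clsC].
- by move=> x y [q hq ->] [r hr ->]; exists (Add q r); [apply: pi_add | rewrite clsD].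
- by move=> x y [q hq ->] [r hr ->]; exists (Mul q r); [apply: pi_mul | rewrite clsM].
- by move=> x [t ht ->]; exists t => //; apply: pi_gen.
exists (rep b), q; split=> //.
by apply/clsP; rewrite clsD cls_dQ repK.
Qed.
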